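(* Let $n\ge 2$. (i) If $\mathcal L$ is a cabled linkage in $\mathbb R^n$, then $\mathcal C(\mathcal L)$ is isomorphic to $X\times(\mathbb R^n)^k$ for some compact quasialgebraic set $X$, where $k$ is the number of connected components of $\mathcal L$ containing no fixed vertex. (ii) Conversely, if $X\subset(\mathbb R^n)^j$ is a compact quasialgebraic set and $k\ge 0$, then there is a cabled linkage $\mathcal L$ in $\mathbb R^n$ such that $\mathcal C(\mathcal L)$ is analytically isomorphic to $X\times(\mathbb R^n)^k$. In fact there is an analytic function $\alpha\colon X\times(\mathbb R^n)^k\to(\mathbb R^n)^m$ such that (after ordering the vertices) $$\mathcal C(\mathcal L)=\{(x,\alpha(x,y))\mid x\in X,\ y\in(\mathbb R^n)^k\},$$ and the map $(x,y)\mapsto(x,\alpha(x,y))$ is an analytic isomorphism onto $\mathcal C(\mathcal L)$.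
   Context: A cabled linkage in $\mathbb R^n$ is a quintuple $\mathcal L=(L,\ell,V,\mu,F)$ where $L$ is a finite one-dimensional simplicial complex (vertex set $\mathcal V(L)$, edge set $\mathcal E(L)$, each edge joining two distinct vertices), $\ell\colon\mathcal E(L)\to(0,\infty)$, $V\subset\mathcal V(L)$ is the set of fixed vertices, $\mu\colon V\to\mathbb R^n$, and $F\subset\mathcal E(L)$ is the set of flexible edges. Its configuration space is $\mathcal C(\mathcal L)=\{\varphi\colon\mathcal V(L)\to\mathbb R^n\mid \varphi(v)=\mu(v)\ (v\in V),\ |\varphi(v)-\varphi(w)|\le\ell(vw)\ (vw\in F),\ |\varphi(v)-\varphi(w)|=\ell(vw)\ (vw\in\mathcal E(L)\setminus F)\}\subset(\mathbb R^n)^{\mathcal V(L)}$. Connected components of $\mathcal L$ are those of the graph $L$. A quasialgebraic set is a subset of some $\mathbb R^N$ of the form $\{x\mid p_i(x)=0\ (i=1,\dots,a),\ q_j(x)\ge 0\ (j=1,\dots,b)\}$ for real polynomials $p_i,q_j$. For $X\subset\mathbb R^a$, $Y\subset\mathbb R^b$, a homeomorphism $f\colon X\to Y$ is an isomorphism if $f$ and $f^{-1}$ are restrictions of entire rational functions, and an analytic isomorphism if $f$ and $f^{-1}$ are restrictions of analytic maps. *)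

(* Defs.v *)
From HB Require Import structures.
From mathcomp Require Import all_boot all_order all_algebra.
From mathcomp Require Import mpoly. (* must come before analysis: notation levels *)
From mathcomp Require Import all_classical all_reals all_analysis.
Import numFieldNormedType.Exports.

Set Implicit Arguments.
Unset Strict Implicit.
Unset Printing Implicit Defensive.

Import Order.TTheory GRing.Theory Num.Theory.
Local Open Scope classical_set_scope.
Local Open Scope ring_scope.

Section Defs.
Variable R : realType.

(* Euclidean spaces.  R^N is represented as [I -> R] for a finite type
   of coordinates [I]; e.g. (R^n)^V is [V * 'I_n -> R], and a product
   A x B of subsets of R^I and R^J lives in R^(I+J) = [I + J -> R].     *)

Definition peval (I : finType) (p : mpoly.mpoly #|I| R) (x : I -> R) : R :=
  mpoly.meval (fun k => x (enum_val k)) p.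

Definition quasialgebraic (I : finType) (X : set (I -> R)) : Prop :=
  exists ps qs : seq (mpoly.mpoly #|I| R),
    X = [set x | (forall p : mpoly.mpoly #|I| R, p \in ps -> peval p x = 0) /\
                 (forall q : mpoly.mpoly #|I| R, q \in qs -> 0 <= peval q x)].

Definition compact_set (I : finType) (X : set (I -> R)) : Prop :=
  @compact {ptws I -> R} X.

Definition open_set (I : finType) (U : set (I -> R)) : Prop :=
  @open {ptws I -> R} U.

Definition entire_rational (I J : finType) (F : (I -> R) -> (J -> R)) : Prop :=
  forall j : J, exists p q : mpoly.mpoly #|I| R,
    (forall x, peval q x != 0) /\ (forall x, F x j = peval p x / peval q x).

Definition restr_entire_rational (I J : finType) (X : set (I -> R))
    (f : (I -> R) -> (J -> R)) : Prop :=
  exists F, entire_rational F /\ forall x, X x -> F x = f x.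

(* Unconditional (equivalently, for real series, absolute) summability
   of a family indexed by an eqType, with sum [s]. *)
Definition has_sum (M : eqType) (a : M -> R) (s : R) : Prop :=
  forall e : R, 0 < e -> exists S0 : seq M, forall S : seq M,
    uniq S -> {subset S0 <= S} -> `|\sum_(m <- S) a m - s| < e.

Definition analytic_at (I : finType) (f : (I -> R) -> R) (p : I -> R) : Prop :=
  exists (r : R) (c : {ffun I -> nat} -> R), 0 < r /\
    forall x : I -> R, (forall i, `|x i - p i| < r) ->
      has_sum (fun a : {ffun I -> nat} =>
                 c a * \prod_(i : I) (x i - p i) ^+ (a i)) (f x).

Definition restr_analytic (I J : finType) (X : set (I -> R))
    (f : (I -> R) -> (J -> R)) : Prop :=
  exists (U : set (I -> R)) (F : (I -> R) -> (J -> R)),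
    [/\ open_set U, X `<=` U,
        (forall p, U p -> forall j, analytic_at (fun x => F x j) p) &
        (forall x, X x -> F x = f x)].

Definition iso_of_class
    (cls : forall I J : finType, set (I -> R) -> ((I -> R) -> (J -> R)) -> Prop)
    (I J : finType) (X : set (I -> R)) (Y : set (J -> R))
    (f : (I -> R) -> (J -> R)) : Prop :=
  cls I J X f /\ exists g : (J -> R) -> (I -> R),
    [/\ cls J I Y g,
        (forall x, X x -> Y (f x)),
        (forall y, Y y -> X (g y)),
        (forall x, X x -> g (f x) = x) &
        (forall y, Y y -> f (g y) = y)].

Definition isomorphism (I J : finType) (X : set (I -> R)) (Y : set (J -> R))
    (f : (I -> R) -> (J -> R)) : Prop :=
  iso_of_class (@restr_entire_rational) X Y f.

Definition analytic_isomorphism (I J : finType) (X : set (I -> R))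
    (Y : set (J -> R)) (f : (I -> R) -> (J -> R)) : Prop :=
  iso_of_class (@restr_analytic) X Y f.

Record cabled_linkage (n : nat) (V : finType) := CabledLinkage {
  cl_edges : {set {set V}};
  cl_len : {set V} -> R;
  cl_fixed : {set V};
  cl_mu : V -> 'I_n -> R;                   (* mu (relevant on fixed vertices) *)
  cl_flex : {set {set V}};
  cl_edges2 : forall e, e \in cl_edges -> #|e| = 2%N;
  cl_len_pos : forall e, e \in cl_edges -> 0 < cl_len e;
  cl_flex_sub : cl_flex \subset cl_edges }.

Variables (n : nat) (V : finType).

Definition vdist (phi : V * 'I_n -> R) (v w : V) : R :=
  Num.sqrt (\sum_(i < n) (phi (v, i) - phi (w, i)) ^+ 2).

Definition config_space (L : cabled_linkage n V) : set (V * 'I_n -> R) :=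
  [set phi | (forall v, v \in cl_fixed L -> forall i, phi (v, i) = cl_mu L v i) /\
     (forall v w, [set v; w]%SET \in cl_edges L ->
        if [set v; w]%SET \in cl_flex L
        then vdist phi v w <= cl_len L [set v; w]%SET
        else vdist phi v w == cl_len L [set v; w]%SET)].

Definition ladj (L : cabled_linkage n V) : rel V :=
  fun v w => [set v; w]%SET \in cl_edges L.

Definition lcomponents (L : cabled_linkage n V) : {set {set V}} :=
  [set [set w | connect (ladj L) v w]%SET | v : V]%SET.

Definition n_free_components (L : cabled_linkage n V) : nat :=
  #|[set C in lcomponents L | [disjoint C & cl_fixed L]]%SET|.

End Defs.

Definition prod_space (R : realType) (n k : nat) (I : finType) (X : set (I -> R))
  : set ((I + 'I_k * 'I_n)%type -> R) :=
  [set z | X (fun i => z (inl i))].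
Arguments prod_space {R} n k {I} X.

Definition graph_map (R : realType) (n j k m : nat)
    (alpha : ((('I_j * 'I_n) + ('I_k * 'I_n))%type -> R) -> ('I_m * 'I_n -> R))
    (z : (('I_j * 'I_n) + ('I_k * 'I_n))%type -> R)
  : ('I_j + 'I_m) * 'I_n -> R :=
  fun p => match p with
           | (inl a, i) => z (inl (a, i))
           | (inr b, i) => alpha z (b, i)
           end.

(* Main.v *)
Require Import Defs.
From HB Require Import structures.
From mathcomp Require Import all_boot all_order all_algebra.
From mathcomp Require Import mpoly.
From mathcomp Require Import all_classical all_reals all_analysis.
From mathcomp Require Import ring lra zify.
Import numFieldNormedType.Exports.

Set Implicit Arguments.
Unset Strict Implicit.
Unset Printing Implicit Defensive.

Import Order.TTheory GRing.Theory Num.Theory.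
Local Open Scope classical_set_scope.
Local Open Scope ring_scope.

(* The free components of a linkage can be translated independently: placing a
   base vertex of each of them at the origin leaves a compact set and splits off
   one factor R^n per free component.

   Conversely, the linkages that realize X are assembled from gadgets whose new
   vertices are forced to be given analytic functions of the input vertices on a
   bounded box.  A rod-and-cable elbow with fixed shoulder [c] turns every
   vertex [f] into a chain [c, e, f] of constant distances; parallelograms
   (braced by the line joining two midpoints) then add such chains and scale
   them, so that the computable functions form a vector space.  The two elbows
   over the same shoulder are symmetric with respect to the projection of [f] to
   a plane, so sums of elbows yield the inversion [f |-> f / |f|^2] in a
   coordinate plane; composing inversions gives coordinate projections, squares
   and hence all polynomials.  Finally, the equations [p = 0] are imposed by
   fixing vertices and the inequalities [q >= 0] by cables. *)

(** Rods have constant length while the vectors to be added and scaled vary, so a parallelogram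
    cannot carry them directly; the elbow replaces a varying vector by two of constant length. The
    second difficulty is exactness: the configuration space has to be the graph of [alpha], not
    merely to project onto [X], so every auxiliary vertex must have exactly one position for each
    input, and this position must be analytic. Hence the brace, which excludes all other
    quadrilaterals with the same sides, and the cable of the elbow, which selects one of two
    positions. Lengths are chosen so that these two positions never merge: the discriminant stays
    strictly positive on the whole box and its square root is analytic. This restricts the
    admissible ranges, so all constructions work with functions bounded on an open box and rescale
    where necessary. The box exists because [X] is compact, and cables confine the inputs to it.
    Analyticity is tracked through coefficient norms of power series; inverses and square roots come
    from geometrically converging iterations. *)

Section UnconditionalSums.
Variable R : realType.

Lemma has_sum_eq (M : eqType) (a b : M -> R) s :
  a =1 b -> has_sum a s -> has_sum b s.
Proof. by move=> /funext ->. Qed.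

Lemma has_sum_cofinal (M : eqType) (a : M -> R) s e (S1 : seq M) :
  has_sum a s -> 0 < e -> exists S : seq M,
    [/\ uniq S, {subset S1 <= S} & `|\sum_(m <- S) a m - s| < e].
Proof.
move=> h /h[S0 hS0]; exists (undup (S0 ++ S1)); split.
- exact: undup_uniq.
- by move=> m mS; rewrite mem_undup mem_cat mS orbT.
- by apply: hS0; [exact: undup_uniq|move=> m mS; rewrite mem_undup mem_cat mS].
Qed.

Lemma has_sum_unique (M : eqType) (a : M -> R) s t :
  has_sum a s -> has_sum a t -> s = t.
Proof.
move=> hs ht; apply/eqP; rewrite -subr_eq0 -normr_le0 leNgt; apply/negP => h.
have h2 : 0 < `|s - t| / 2 by rewrite divr_gt0.
have [S0 hS0] := ht _ h2.
have [S [uS sS hS]] := has_sum_cofinal S0 hs h2.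
have := hS0 _ uS sS; have -> : s - t = (\sum_(m <- S) a m - t) - (\sum_(m <- S) a m - s) by ring.
have := ler_normB (\sum_(m <- S) a m - t) (\sum_(m <- S) a m - s).
rewrite -(_ : s - t = (\sum_(m <- S) a m - t) - (\sum_(m <- S) a m - s)); last by ring.
lra.
Qed.

Lemma mem_cat_l (M : eqType) (S1 S2 : seq M) m : m \in S1 -> m \in S1 ++ S2.
Proof. by rewrite mem_cat => ->. Qed.

Lemma mem_cat_r (M : eqType) (S1 S2 : seq M) m : m \in S2 -> m \in S1 ++ S2.
Proof. by rewrite mem_cat orbC => ->. Qed.

Lemma has_sumD (M : eqType) (a b : M -> R) s t :
  has_sum a s -> has_sum b t -> has_sum (fun m => a m + b m) (s + t).
Proof.
move=> ha hb e e0; have e2 : 0 < e / 2 by rewrite divr_gt0.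
have [S1 h1] := ha _ e2; have [S2 h2] := hb _ e2.
exists (S1 ++ S2) => S uS sS.
have k1 := h1 S uS (fun m mS => sS m (mem_cat_l _ mS)).
have k2 := h2 S uS (fun m mS => sS m (mem_cat_r _ mS)).
rewrite big_split /=.
rewrite (_ : _ - _ = (\sum_(m <- S) a m - s) + (\sum_(m <- S) b m - t)); last by ring.
by apply: (le_lt_trans (ler_normD _ _)); lra.
Qed.

Lemma has_sumZ (M : eqType) (a : M -> R) s k :
  has_sum a s -> has_sum (fun m => k * a m) (k * s).
Proof.
move=> ha e e0; have e2 : 0 < e / (`|k| + 1) by rewrite divr_gt0// ltr_wpDl.
have [S1 h1] := ha _ e2; exists S1 => S uS sS; have := h1 S uS sS.
rewrite -mulr_sumr -mulrBr normrM ltr_pdivlMr; last by rewrite ltr_wpDl.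
by apply: le_lt_trans; rewrite mulrC ler_wpM2l// lerDl.
Qed.

Definition sum_le (M : eqType) (a : M -> R) K :=
  forall S : seq M, uniq S -> \sum_(m <- S) a m <= K.

Definition abs_le (M : eqType) (a : M -> R) K := sum_le (fun m => `|a m|) K.

(** The sum is the supremum of the finite sums: a finite family that comes within [e] of it stays
    there when enlarged, because the added terms are nonnegative. *)
Lemma nneg_has_sum (M : eqType) (a : M -> R) K :
  (forall m, 0 <= a m) -> sum_le a K -> exists s, has_sum a s.
Proof.
move=> a0 aK; pose A := [set \sum_(m <- S) a m | S in [set S : seq M | uniq S]].
have hA : has_sup A.
  split; first by exists (\sum_(m <- [::]) a m); exists [::].
  by exists K => _ [S uS <-]; exact: aK.
exists (sup A) => e e0.
have [_ [S0 uS0 <-] hS0] := sup_adherent e0 hA.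
exists S0 => S uS sS.
have h1 : \sum_(m <- S) a m <= sup A.
  by apply: sup_upper_bound => //; exists S.
have h2 : \sum_(m <- S0) a m <= \sum_(m <- S) a m.
  have pS : perm_eq S (S0 ++ [seq m <- S | m \notin S0]).
    apply: uniq_perm => //.
      rewrite cat_uniq uS0 filter_uniq// andbT -all_predC; apply/allP => m /=.
      by rewrite mem_filter => /andP[].
    move=> m; rewrite mem_cat mem_filter; case: (boolP (m \in S0)) => //=.
    by move=> /sS ->.
  by rewrite (perm_big _ pS)/= big_cat/= lerDl; apply: sumr_ge0.
rewrite ltr_norml; apply/andP; split; lra.
Qed.

Lemma has_sum_norm_le (M : eqType) (a : M -> R) s K :
  has_sum a s -> abs_le a K -> `|s| <= K.
Proof.
move=> hs aK; apply/ler_addgt0Pr => e /(has_sum_cofinal [::] hs)[S [uS _ h]].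
have := aK S uS; have := ler_norm_sum S a xpredT.
have := ler_normB (\sum_(m <- S) a m) (\sum_(m <- S) a m - s).
by rewrite opprB addrC subrK; lra.
Qed.

(** [a] is the difference of the nonnegative families [a + |a|] and [|a|], both with bounded finite
    sums. *)
Lemma abs_has_sum (M : eqType) (a : M -> R) K :
  abs_le a K -> exists s, has_sum a s.
Proof.
move=> aK; have [//|t ht] := nneg_has_sum _ aK.
have [||s hs] := @nneg_has_sum M (fun m => a m + `|a m|) (K + K).
- by move=> m; have := ler_norm (- a m); rewrite normrN; lra.
- move=> S uS; rewrite big_split/=; have := aK S uS.
  have : \sum_(m <- S) a m <= \sum_(m <- S) `|a m|.
    by apply: ler_sum => m _; exact: ler_norm.
  lra.
exists (s + -1 * t); apply: has_sum_eq (has_sumD hs (has_sumZ (-1) ht)) => m /=.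
ring.
Qed.

(* Each fibre sum is approximated on a common finite set, which may be enlarged
   so as to lie above the part of the domain where the total sum is reached. *)
Lemma has_sum_regroup (N M : eqType) (a : N -> R) (pi : N -> M) (b : M -> R) s :
  has_sum a s -> (forall m, has_sum (fun x => (pi x == m)%:R * a x) (b m)) ->
  has_sum b s.
Proof.
move=> ha hb e e0; have e2 : 0 < e / 2 by rewrite divr_gt0.
have [S0 hS0] := ha _ e2; exists (map pi S0) => T uT sT.
have e3 : 0 < e / 2 / ((size T)%:R + 1) by rewrite divr_gt0// ltr_wpDl.
pose G m := proj1_sig (cid (hb m _ e3)).
have hG m S : uniq S -> {subset G m <= S} ->
  `|\sum_(x <- S) (pi x == m)%:R * a x - b m| < e / 2 / ((size T)%:R + 1).
  by rewrite /G; case: (cid _) => S' /= h; exact: h.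
pose S := undup (S0 ++ flatten (map G T)).
have uS : uniq S by exact: undup_uniq.
pose S' := [seq x <- S | pi x \in T].
have k1 : `|\sum_(x <- S') a x - s| < e / 2.
  apply: hS0; first exact: filter_uniq.
  move=> x xS; rewrite mem_filter mem_undup mem_cat xS/= andbT.
  by apply: sT; exact: map_f.
have k2 : \sum_(x <- S') a x = \sum_(m <- T) \sum_(x <- S) (pi x == m)%:R * a x.
  rewrite exchange_big big_filter [LHS]big_mkcond/=; apply: eq_bigr => x _.
  rewrite -mulr_suml; case: ifPn => xT.
    rewrite (bigD1_seq (pi x))//= eqxx big1 ?addr0 ?mul1r// => m.
    by rewrite eq_sym => /negbTE ->.
  rewrite big_seq big1 ?mul0r// => m mT.
  by case: eqP => // xm; rewrite xm mT in xT.
have k3 : `|\sum_(m <- T) b m - \sum_(x <- S') a x| <= e / 2.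
  rewrite k2 -sumrB; apply: (le_trans (ler_norm_sum _ _ _)).
  apply: (@le_trans _ _ (\sum_(m <- T) e / 2 / ((size T)%:R + 1))).
    rewrite big_seq [leRHS]big_seq; apply: ler_sum => m mT.
    rewrite distrC; apply/ltW/hG => // x xG; rewrite mem_undup mem_cat.
    by apply/orP; right; apply/flattenP; exists (G m) => //; exact: map_f.
  rewrite big_const_seq count_predT iter_addr_0 -[leLHS]mulr_natr.
  rewrite -mulrA ger_pMr// mulrC ler_pdivrMr ?mul1r ?lerDl// ltr_wpDl//.
rewrite (_ : _ - s = (\sum_(m <- T) b m - \sum_(x <- S') a x)
  + (\sum_(x <- S') a x - s)); last by ring.
by apply: (le_lt_trans (ler_normD _ _)); lra.
Qed.

End UnconditionalSums.

(** * Absolutely summable families: products, double series, geometric bounds *)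

Section AbsoluteSummability.
Variable R : realType.

Lemma abs_le_mono (M : eqType) (a b : M -> R) K :
  (forall m, `|a m| <= `|b m|) -> abs_le b K -> abs_le a K.
Proof. by move=> ab bK S /bK; apply: le_trans; apply: ler_sum. Qed.

Lemma abs_le_weaken (M : eqType) (a : M -> R) K K' :
  K <= K' -> abs_le a K -> abs_le a K'.
Proof. by move=> KK aK S /aK /le_trans; exact. Qed.

Lemma has_sum0 (M : eqType) : has_sum (fun _ : M => 0) (0 : R).
Proof. by move=> e e0; exists [::] => S _ _; rewrite big1// subrr normr0. Qed.

Lemma has_sum_finite_sum (M N : eqType) (T : seq N) (a : N -> M -> R) s :
  (forall n, has_sum (a n) (s n)) ->
  has_sum (fun m => \sum_(n <- T) a n m) (\sum_(n <- T) s n).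
Proof.
move=> h; elim: T => [|n T IH].
  by rewrite big_nil; apply: has_sum_eq (has_sum0 _) => m; rewrite big_nil.
rewrite big_cons; apply: has_sum_eq (has_sumD (h n) IH) => m.
by rewrite big_cons.
Qed.

(** Multiplying each fibre sum by its sign turns the sum of absolute values into the sum of a single
    family; that family is dominated termwise by [|a|], because a point lies in only one fibre. *)
Lemma abs_le_regroup (N M : eqType) (a : N -> R) (pi : N -> M) (b : M -> R) C :
  abs_le a C -> (forall m, has_sum (fun x => (pi x == m)%:R * a x) (b m)) ->
  abs_le b C.
Proof.
move=> aC hb T uT.
pose sg m := Num.sg (b m).
have hs := has_sum_finite_sum T (fun m => has_sumZ (sg m) (hb m)).
have -> : \sum_(m <- T) `|b m| = \sum_(m <- T) sg m * b m.
  by apply: eq_bigr => m _; rewrite normrEsg.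
apply: (le_trans (ler_norm _)); apply: (has_sum_norm_le hs).
apply: abs_le_mono aC => x; apply: (le_trans (ler_norm_sum _ _ _)).
case: (boolP (pi x \in T)) => xT.
  rewrite (bigD1_seq (pi x))//= eqxx mul1r big1 => [|m].
    by rewrite addr0 normrM ler_piMl// normr_sg; case: (_ == 0).
  by rewrite eq_sym => /negbTE ->; rewrite mul0r mulr0 normr0.
rewrite big_seq big1// => m mT.
case: eqP => [xm|]; last by rewrite mul0r mulr0 normr0.
by rewrite xm mT in xT.
Qed.

Lemma abs_le_pair (M N : eqType) (F : M * N -> R) C :
  (forall T1 T2, uniq T1 -> uniq T2 ->
     \sum_(m <- T1) \sum_(n <- T2) `|F (m, n)| <= C) -> abs_le F C.
Proof.
move=> h S uS.
pose T1 := undup (map fst S); pose T2 := undup (map snd S).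
apply: (le_trans _ (h T1 T2 (undup_uniq _) (undup_uniq _))).
rewrite -(@big_allpairs _ _ _ _ _ T1 T2 (fun p => `|F p|)).
have pS : perm_eq S [seq p <- [seq (m, n) | m <- T1, n <- T2] | p \in S].
  apply: uniq_perm => //.
    by rewrite filter_uniq// allpairs_uniq ?undup_uniq// => -[? ?] [? ?].
  move=> [m n]; rewrite mem_filter andbC; case: (boolP (_ \in S)) => [mS|]; last by rewrite andbF.
  rewrite andbT; apply/esym/allpairsP; exists (m, n); split => //=;
    by rewrite mem_undup; apply/mapP; exists (m, n).
rewrite (perm_big _ pS) big_filter [leLHS]big_mkcond; apply: ler_sum => p _.
by case: ifP.
Qed.

Lemma has_sum_fst (M N : eqType) (F : M * N -> R) m s :
  has_sum (fun n => F (m, n)) s -> has_sum (fun p => (p.1 == m)%:R * F p) s.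
Proof.
move=> h e /h[S0 hS0]; exists [seq (m, n) | n <- S0] => S uS sS.
pose S' := [seq p.2 | p <- S & p.1 == m].
have -> : \sum_(p <- S) (p.1 == m)%:R * F p = \sum_(n <- S') F (m, n).
  rewrite big_map big_filter [RHS]big_mkcond/=; apply: eq_bigr => -[m' n] _ /=.
  by case: eqP => [->|]; rewrite ?mul1r ?mul0r.
apply: hS0.
  rewrite map_inj_in_uniq ?filter_uniq// => -[m1 n1] [m2 n2].
  by rewrite !mem_filter/= => /andP[/eqP-> _] /andP[/eqP-> _] ->.
move=> n nS; apply/mapP; exists (m, n) => //.
by rewrite mem_filter/= eqxx; apply: sS; exact: map_f.
Qed.

(** The absolute bound supplies some sum of the double family; grouping its terms by the first index
    shows that this sum is the iterated one. *)
Lemma has_sum_fubini (M N : eqType) (F : M * N -> R) b s C :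
  abs_le F C -> (forall m, has_sum (fun n => F (m, n)) (b m)) ->
  has_sum b s -> has_sum F s.
Proof.
move=> /abs_has_sum[t ht] hb bs.
by rewrite (has_sum_unique bs (has_sum_regroup ht (fun m => has_sum_fst (hb m)))).
Qed.

Lemma abs_leM (M N : eqType) (a : M -> R) (b : N -> R) K L :
  abs_le a K -> abs_le b L -> abs_le (fun p => a p.1 * b p.2) (K * L).
Proof.
move=> aK bL; apply: abs_le_pair => T1 T2 u1 u2 /=.
under eq_bigr do under eq_bigr do rewrite normrM.
under eq_bigr do rewrite -mulr_sumr; rewrite -mulr_suml.
by apply: ler_pM; rewrite ?sumr_ge0//; [exact: aK|exact: bL].
Qed.

Lemma has_sumM (M N : eqType) (a : M -> R) (b : N -> R) s t K L :
  abs_le a K -> abs_le b L -> has_sum a s -> has_sum b t ->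
  has_sum (fun p => a p.1 * b p.2) (s * t).
Proof.
move=> aK bL sa tb; apply: (has_sum_fubini (abs_leM aK bL)) => [m|] /=.
  exact: has_sumZ tb.
by rewrite mulrC; apply: has_sum_eq (has_sumZ t sa) => m; rewrite mulrC.
Qed.

Lemma abs_le_geometric (M : eqType) (F : nat * M -> R) C :
  (forall k, abs_le (fun m => F (k, m)) (C / 2 ^+ k)) -> 0 <= C ->
  abs_le F (C + C).
Proof.
move=> h C0; apply: abs_le_pair => T1 T2 u1 u2.
have geo n : \sum_(k < n) C / 2 ^+ k <= C + C - C / 2 ^+ n * 2.
  elim: n => [|n IH]; first by rewrite big_ord0; lra.
  rewrite big_ord_recr/= exprS invfM; move: IH; set q := (_ ^+ _)^-1; lra.
have [n nT] : exists n, {subset T1 <= iota 0 n}.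
  exists (\max_(k <- T1) k).+1 => k kT; rewrite mem_iota/= add0n ltnS.
  exact: leq_bigmax_seq.
apply: (@le_trans _ _ (\sum_(k < n) C / 2 ^+ k)); last first.
  by apply: (le_trans (geo n)); rewrite gerBl mulr_ge0// divr_ge0// exprn_ge0.
apply: (@le_trans _ _ (\sum_(k <- T1) C / 2 ^+ k)).
  by apply: ler_sum => k _; exact: h.
rewrite -(big_mkord xpredT (fun k => C / 2 ^+ k)) /index_iota subn0.
have pS : perm_eq T1 [seq p <- iota 0 n | p \in T1].
  apply: uniq_perm => //; first by rewrite filter_uniq ?iota_uniq.
  by move=> k; rewrite mem_filter; case: (boolP (k \in T1)) => // /nT ->.
rewrite (perm_big _ pS) big_filter [leLHS]big_mkcond; apply: ler_sum => p _.
by case: ifP => // _; rewrite divr_ge0// exprn_ge0.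
Qed.

Lemma pow2_small (C e : R) : 0 < e -> exists N : nat, C / 2 ^+ N < e.
Proof.
move=> e0; have [N hN] : exists N : nat, C / e < N%:R.
  exists (Num.bound `|C / e|).
  exact: (le_lt_trans (ler_norm _) (archi_boundP (normr_ge0 _))).
exists N; rewrite ltr_pdivrMr ?exprn_gt0// mulrC -ltr_pdivrMr//.
apply: (lt_le_trans hN); rewrite -natrX ler_nat ltnW//; exact: ltn_expl.
Qed.

(** The absolute bound provides an unordered sum; the estimate on initial segments then identifies
    its value. *)
Lemma has_sum_nat_geometric (a : nat -> R) K C s : abs_le a K ->
  (forall N, `|\sum_(k < N) a k - s| <= C / 2 ^+ N) -> has_sum a s.
Proof.
move=> /abs_has_sum[t ta] h; suff -> : s = t by [].
apply/eqP; rewrite -subr_eq0 -normr_le0; apply/ler_addgt0Pr => e e0; rewrite add0r.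
have e2 : 0 < e / 2 by rewrite divr_gt0.
have [S0 hS0] := ta _ e2; have [N1 hN1] := pow2_small C e2.
pose N := maxn N1 (\max_(k <- S0) k).+1.
have k1 := h N.
have k2 : `|\sum_(k < N) a k - t| < e / 2.
  rewrite -(big_mkord xpredT a) /index_iota subn0; apply: hS0; first exact: iota_uniq.
  move=> k kS; rewrite mem_iota/= add0n leq_max ltnS; apply/orP; right.
  exact: leq_bigmax_seq.
have C0 : 0 <= C.
  by have := le_trans (normr_ge0 _) (h 0); rewrite expr0 divr1.
have k3 : C / 2 ^+ N <= C / 2 ^+ N1.
  rewrite ler_wpM2l// lef_pV2 ?posrE ?exprn_gt0//.
  by rewrite ler_weXn2l ?leq_maxl// ler1n.
have := ler_normB (\sum_(k < N) a k - t) (\sum_(k < N) a k - s).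
rewrite (_ : _ - _ - _ = s - t); last by ring.
lra.
Qed.

End AbsoluteSummability.

(** * Power series with bounded coefficient norm on a polydisc *)

Section PowerSeries.
Variables (R : realType) (I : finType).
Implicit Types (p x : I -> R) (f g : (I -> R) -> R) (a : {ffun I -> nat}).

Definition monom (h : I -> R) a := \prod_(i : I) h i ^+ a i.

(* The weighted l^1 norm of the coefficients is submultiplicative and complete,
   which is what the series and fixed-point arguments need. *)
Definition psn p r K f := exists c : {ffun I -> nat} -> R,
  abs_le (fun a => c a * monom (fun=> r) a) K /\
  forall x, (forall i, `|x i - p i| < r) ->
    has_sum (fun a => c a * monom (fun i => x i - p i) a) (f x).

Lemma monom_gt0 r a : 0 < r -> 0 < monom (fun=> r) a.
Proof. by move=> r0; apply: prodr_gt0 => i _; exact: exprn_gt0. Qed.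

Lemma monom_le (h k : I -> R) a :
  (forall i, `|h i| <= `|k i|) -> `|monom h a| <= `|monom k a|.
Proof.
move=> hk; rewrite !normr_prod; apply: ler_prod => i _.
by rewrite normr_ge0 !normrX; apply: lerXn2r; rewrite ?nnegrE.
Qed.

Lemma monomD (h : I -> R) a b :
  monom h a * monom h b = monom h [ffun i => (a i + b i)%N].
Proof. by rewrite -big_split; apply: eq_bigr => i _; rewrite ffunE exprD. Qed.

Lemma abs_le_ball p r x (N : eqType) (pi : N -> {ffun I -> nat}) d K :
  (forall i, `|x i - p i| < r) ->
  abs_le (fun n => d n * monom (fun=> r) (pi n)) K ->
  abs_le (fun n => d n * monom (fun i => x i - p i) (pi n)) K.
Proof.
move=> xr; apply: abs_le_mono => n; rewrite !normrM ler_wpM2l//.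
apply: monom_le => i; apply: (le_trans (ltW (xr i))); exact: ler_norm.
Qed.

Lemma psn_bound p r K f x :
  psn p r K f -> (forall i, `|x i - p i| < r) -> `|f x| <= K.
Proof.
move=> [c [cK h]] xr; apply: (has_sum_norm_le (h _ xr)).
exact: (abs_le_ball (pi := id)).
Qed.

Lemma psn_eq p r K f g :
  (forall x, (forall i, `|x i - p i| < r) -> f x = g x) ->
  psn p r K f -> psn p r K g.
Proof. by move=> fg [c [cK h]]; exists c; split=> // x xr; rewrite -fg//; exact: h. Qed.

Lemma psn_weaken p r K K' f : K <= K' -> psn p r K f -> psn p r K' f.
Proof. by move=> KK [c [cK h]]; exists c; split=> //; exact: abs_le_weaken cK. Qed.

(** Products and series first yield terms indexed by some [N], with repeated exponents [pi n]; here
    like monomials are collected. The new coefficients are fibre sums taken at radius [r], divided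
    by the positive value of the monomial there. *)
Lemma psn_regroup p r C f (N : eqType) (pi : N -> {ffun I -> nat}) d : 0 < r ->
  abs_le (fun n => d n * monom (fun=> r) (pi n)) C ->
  (forall x, (forall i, `|x i - p i| < r) ->
     has_sum (fun n => d n * monom (fun i => x i - p i) (pi n)) (f x)) ->
  psn p r C f.
Proof.
move=> r0 dC hf.
have fib a : exists b, has_sum (fun n => (pi n == a)%:R * (d n * monom (fun=> r) (pi n))) b.
  apply: abs_has_sum; apply: abs_le_mono dC => n.
  by case: eqP; rewrite ?mul1r// mul0r normr0.
pose b a := proj1_sig (cid (fib a)).
have hb a : has_sum (fun n => (pi n == a)%:R * (d n * monom (fun=> r) (pi n))) (b a).
  by rewrite /b; case: (cid _).
have rN0 a : monom (fun=> r) a != 0 by rewrite gt_eqF// monom_gt0.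
exists (fun a => b a / monom (fun=> r) a); split.
  have := abs_le_regroup dC hb; apply: abs_le_mono => a.
  by rewrite divfK.
move=> x xr; apply: (has_sum_regroup (pi := pi) (hf x xr)) => a.
rewrite mulrAC -mulrA mulrC; apply: has_sum_eq (has_sumZ _ (hb a)) => n /=.
case: eqP => [<-|]; last by rewrite !mul0r mulr0.
by rewrite !mul1r mulrCA divfK.
Qed.

Lemma psn_monom p r a c : 0 < r ->
  psn p r (`|c| * monom (fun=> r) a) (fun x => c * monom (fun i => x i - p i) a).
Proof.
move=> r0; apply: (@psn_regroup p r _ _ unit (fun=> a) (fun=> c)) => //.
  move=> S uS; have : (size S <= 1)%N.
    by move: uS; case: S => [|[] [|[] S]] //=; rewrite inE.
  rewrite big_const_seq count_predT iter_addr_0 normrM.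
  rewrite (gtr0_norm (monom_gt0 a r0)).
  by case: (size S) => [|[|]]// _; rewrite mulr_ge0// ltW// monom_gt0.
move=> x _ e e0; exists [:: tt] => S uS sS.
have -> : S = [:: tt].
  move: uS sS; case: S => [_ /(_ tt (mem_head _ _))|[] [|[] S]] //=.
by rewrite big_seq1 subrr normr0.
Qed.

Lemma psn_const p r c : 0 < r -> psn p r `|c| (fun=> c).
Proof.
move=> r0; have E h : monom h [ffun=> 0%N] = 1.
  by rewrite /monom big1// => i _; rewrite ffunE expr0.
have := psn_monom p [ffun=> 0%N] c r0; rewrite E mulr1.
by apply: psn_eq => x _; rewrite E mulr1.
Qed.

Lemma psn_coord p r i : 0 < r -> psn p r r (fun x => x i - p i).
Proof.
move=> r0; pose a := [ffun i' => (i' == i) : nat].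
have E h : monom h a = h i.
  rewrite /monom (bigD1 i)//= ffunE eqxx expr1 big1 ?mulr1// => j ji.
  by rewrite ffunE (negbTE ji) expr0.
have := psn_monom p a 1 r0; rewrite E normr1 mul1r.
by apply: psn_eq => x _; rewrite E mul1r.
Qed.

Lemma psnD p r K L f g : psn p r K f -> psn p r L g -> psn p r (K + L) (fun x => f x + g x).
Proof.
move=> [c [cK hc]] [d [dL hd]]; exists (fun a => c a + d a); split.
  move=> S uS; apply: (le_trans _ (lerD (cK S uS) (dL S uS))).
  by rewrite -big_split; apply: ler_sum => a _; rewrite mulrDl ler_normD.
move=> x xr; apply: has_sum_eq (has_sumD (hc x xr) (hd x xr)) => a.
by rewrite mulrDl.
Qed.

Lemma psnM p r K L f g : 0 < r -> psn p r K f -> psn p r L g ->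
  psn p r (K * L) (fun x => f x * g x).
Proof.
move=> r0 [c [cK hc]] [d [dL hd]].
pose pi (q : {ffun I -> nat} * {ffun I -> nat}) := [ffun i => (q.1 i + q.2 i)%N].
apply: (@psn_regroup p r _ _ _ pi (fun q => c q.1 * d q.2)) => //.
  apply: abs_le_mono (abs_leM cK dL) => q /=.
  by rewrite -monomD mulrACA.
move=> x xr; have h1 := abs_le_ball (pi := id) xr cK.
have h2 := abs_le_ball (pi := id) xr dL.
apply: has_sum_eq (has_sumM h1 h2 (hc x xr) (hd x xr)) => q /=.
by rewrite -monomD mulrACA.
Qed.

Lemma psnZ p r K f k : 0 < r -> psn p r K f -> psn p r (`|k| * K) (fun x => k * f x).
Proof. by move=> r0; apply: psnM => //; exact: psn_const. Qed.

Lemma psn_shrink p r r' K f : 0 <= r' -> r' <= r -> psn p r K f -> psn p r' K f.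
Proof.
move=> r0 rr [c [cK h]]; exists c; split=> [|x xr]; last first.
  by apply: h => i; exact: lt_le_trans (xr i) rr.
apply: abs_le_mono cK => a; rewrite !normrM ler_wpM2l//; apply: monom_le => i.
by rewrite !ger0_norm// (le_trans r0).
Qed.

Lemma has_sum_point (M : eqType) (m0 : M) (s : R) :
  has_sum (fun m => (m == m0)%:R * s) s.
Proof.
move=> e e0; exists [:: m0] => S uS sS.
rewrite (bigD1_seq m0)//=; last by apply: sS; rewrite mem_head.
rewrite eqxx mul1r big1 ?addr0 ?subrr ?normr0// => m /negbTE ->.
by rewrite mul0r.
Qed.

(** Without its constant term a series contains only monomials of positive degree, so shrinking the
    radius by a factor [t <= 1] multiplies its norm by at most [t]. *)
Lemma psn_vanish p r K f e : 0 < r -> 0 < e -> psn p r K f ->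
  exists2 r', 0 < r' & psn p r' e (fun x => f x - f p).
Proof.
move=> r0 e0 [c [cK h]].
pose a0 : {ffun I -> nat} := [ffun=> 0%N].
have pp i : `|p i - p i| < r by rewrite subrr normr0.
have K0 : 0 <= K by have := cK [::] isT; rewrite big_nil.
have mon0 a : a != a0 -> exists i, (0 < a i)%N.
  move=> aN; apply/existsP; apply: contraNT aN; rewrite negb_exists => /forallP z.
  by apply/eqP/ffunP => i; have := z i; rewrite ffunE lt0n negbK => /eqP.
have fp : f p = c a0.
  apply: has_sum_unique (h p pp) _; apply: has_sum_eq (has_sum_point a0 (c a0)) => a.
  case: (eqVneq a a0) => [->|/mon0[i ai]].
    by rewrite mul1r /monom big1 ?mulr1// => i _; rewrite ffunE expr0.
  by rewrite mul0r /monom (bigD1 i)//= subrr expr0n gtn_eqF// mul0r mulr0.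
pose t := Num.min 1 (e / (K + 1)).
have t0 : 0 < t by rewrite lt_min ltr01 divr_gt0// ltr_wpDl.
have t1 : t <= 1 by rewrite ge_min lexx.
have tK : t * K <= e.
  have : t <= e / (K + 1) by rewrite ge_min lexx orbT.
  rewrite ler_pdivlMr ?ltr_wpDl// mulrDr mulr1; have := ltW t0; lra.
exists (t * r); first exact: mulr_gt0.
exists (fun a => (a != a0)%:R * c a); split.
  move=> S uS; apply: (le_trans _ tK); apply: (le_trans _ (ler_wpM2l (ltW t0) (cK S uS))).
  rewrite mulr_sumr; apply: ler_sum => a _.
  case: (boolP (a == a0)) => [_|/mon0[i ai]]; first by rewrite mul0r mul0r normr0 mulr_ge0// ltW.
  rewrite mul1r normrM [`|c a * _|]normrM mulrCA ler_wpM2l//.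
  have -> : monom (fun=> t * r) a = monom (fun=> t) a * monom (fun=> r) a.
    by rewrite -big_split; apply: eq_bigr => j _; rewrite exprMn.
  rewrite normrM ler_wpM2r// ger0_norm; last by rewrite ltW// monom_gt0.
  rewrite /monom (bigD1 i)//= -[leRHS]mulr1; apply: ler_pM.
  - by rewrite exprn_ge0// ltW.
  - by rewrite prodr_ge0// => j _; rewrite exprn_ge0// ltW.
  - by rewrite -[leRHS]expr1 ler_wiXn2l// ltW.
  - by apply: prodr_ile1 => j _; rewrite exprn_ge0 ?exprn_ile1// ltW.
move=> x xr; have xr' i : `|x i - p i| < r.
  by apply: (lt_le_trans (xr i)); rewrite ger_pMl.
rewrite fp; have := has_sumD (h x xr') (has_sumZ (-1) (has_sum_point a0 (c a0))).
rewrite mulN1r; apply: has_sum_eq => a /=.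
case: (eqVneq a a0) => [->|_]; last by rewrite mul0r mulr0 addr0 mul1r.
rewrite mul0r {1}/monom big1 => [|i _]; last by rewrite ffunE expr0.
by rewrite mul0r !mul1r mulr1 mulN1r subrr.
Qed.

(** The coefficients of all the [f k] form one double family, whose absolute sums are dominated by a
    geometric series, so the two summations may be exchanged. *)
Lemma psn_series p r C (f : nat -> (I -> R) -> R) F : 0 < r -> 0 <= C ->
  (forall k, psn p r (C / 2 ^+ k) (f k)) ->
  (forall x, (forall i, `|x i - p i| < r) -> has_sum (fun k : nat => f k x) (F x)) ->
  psn p r (C + C) F.
Proof.
move=> r0 C0 hf hF.
pose c k := proj1_sig (cid (hf k)).
have [hc1 hc2] : (forall k, abs_le (fun a => c k a * monom (fun=> r) a) (C / 2 ^+ k)) /\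
    (forall k x, (forall i, `|x i - p i| < r) ->
    has_sum (fun a => c k a * monom (fun i => x i - p i) a) (f k x)).
  by split=> k; rewrite /c; case: (cid _) => ? [].
have ab := abs_le_geometric (F := fun q => c q.1 q.2 * monom (fun=> r) q.2) hc1 C0.
apply: (@psn_regroup p r _ _ _ snd (fun q => c q.1 q.2)) => // x xr.
have ab' := abs_le_ball (pi := snd) xr ab.
by apply: (has_sum_fubini ab') (hF x xr) => k; exact: hc2.
Qed.

End PowerSeries.

(** * Closure of analytic functions under field operations and square roots *)

Section AnalyticClosure.
Variables (R : realType) (I : finType).
Implicit Types (p x : I -> R) (f g : (I -> R) -> R).

Lemma abs_le_nat_geometric (a : nat -> R) C : 0 <= C ->
  (forall k, `|a k| <= C / 2 ^+ k) -> abs_le a (C + C).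
Proof.
move=> C0 h S uS.
have := @abs_le_geometric R unit (fun q => a q.1) C _ C0 [seq (k, tt) | k <- S].
rewrite big_map; apply; last by rewrite map_inj_uniq// => k k' [].
move=> k T uT; have : (size T <= 1)%N by move: uT; case: T => [|[] [|[] T]] //=.
rewrite /= big_const_seq count_predT iter_addr_0.
case: (size T) => [|[|]]// _; first exact: le_trans (normr_ge0 _) (h k).
by rewrite mulr1n.
Qed.

Lemma psnX p r K g k : 0 < r -> psn p r K g -> psn p r (K ^+ k) (fun x => g x ^+ k).
Proof.
move=> r0 hg; elim: k => [|k IH].
  have := psn_const p (1 : R) r0; rewrite normr1; exact: psn_eq.
rewrite exprS; have := psnM r0 hg IH; apply: psn_eq => x _; by rewrite exprS.
Qed.

(** The geometric series in [g]: its terms have norm at most [(1/2)^k]. *)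
Lemma psn_inv_near1 p r g : 0 < r -> psn p r (1 / 2) g ->
  psn p r (1 + 1) (fun x => (1 - g x)^-1).
Proof.
move=> r0 hg; apply: (@psn_series _ _ _ _ _ (fun k x => g x ^+ k)) => // [k|x xr].
  by apply: psn_weaken (psnX k r0 hg); rewrite expr_div_n expr1n.
have gb := psn_bound hg xr.
have gk k : `|g x ^+ k| <= 1 / 2 ^+ k.
  rewrite normrX (_ : 1 / 2 ^+ k = (1 / 2) ^+ k); last by rewrite expr_div_n expr1n.
  by apply: lerXn2r; rewrite ?nnegrE ?normr_ge0 ?divr_ge0.
have g1 : 1 - g x != 0.
  by rewrite gt_eqF// subr_gt0; have := ler_norm (g x); lra.
apply: (has_sum_nat_geometric (C := 2) (abs_le_nat_geometric ler01 gk)) => N.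
have -> : \sum_(k < N) g x ^+ k - (1 - g x)^-1 = - (g x ^+ N) * (1 - g x)^-1.
  apply: (mulIf g1); rewrite mulrBl mulVf// -mulrA mulVf// mulr1.
  have := subrX1 (g x) N; move: (\sum_(k < N) _) => s h.
  by rewrite (_ : g x ^+ N = (g x - 1) * s + 1); [ring|rewrite -h subrK].
rewrite normrM normrN normfV.
have h2 : 1 / 2 <= `|1 - g x|.
  by have := lerB_dist 1 (g x); rewrite normr1; lra.
have h2' : 0 < `|1 - g x| by lra.
rewrite ler_pdivrMr//; apply: (le_trans (gk N)).
have := @invr_ge0 R (2 ^+ N); rewrite exprn_ge0//; set q := (_ ^+ _)^-1 => q0.
nra.
Qed.

Section SquareRootSeries.
Variable g : (I -> R) -> R.

(* Fixed-point iteration for [u = (g - u^2) / 2], whose small root is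
   [sqrt (1 + g) - 1]. *)
Fixpoint sqrt_iter (k : nat) (x : I -> R) : R :=
  if k is k'.+1 then 2^-1 * (g x + -1 * (sqrt_iter k' x * sqrt_iter k' x)) else 0.

Variables (p : I -> R) (r : R).
Hypotheses (r0 : 0 < r) (hg : psn p r (3 / 4) g).

(** The bound 1/2 reproduces itself under the iteration, since [(3/4 + (1/2)^2) / 2 = 1/2]; this is
    where 3/4 comes from. *)
Lemma psn_sqrt_iter k : psn p r (1 / 2) (sqrt_iter k).
Proof.
elim: k => [|k IH] /=.
  have := psn_const p (0 : R) r0; rewrite normr0; apply: psn_weaken; lra.
have := psnZ 2^-1 r0 (psnD hg (psnZ (-1) r0 (psnM r0 IH IH))).
apply: psn_weaken; rewrite normrN1 ger0_norm; lra.
Qed.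

(** For consecutive iterates, [u'' - u' = - (u' + u) (u' - u) / 2], and [u' + u] has norm at most 1,
    so each step halves the difference. *)
Lemma psn_sqrt_iter_diff k :
  psn p r (1 / 2 / 2 ^+ k) (fun x => sqrt_iter k.+1 x + -1 * sqrt_iter k x).
Proof.
elim: k => [|k IH].
  have := psnZ 2^-1 r0 hg => h; apply: psn_weaken (psn_eq _ h).
    by rewrite expr0 ger0_norm; lra.
  by move=> x _ /=; ring.
have := psnZ (- 2^-1) r0 (psnM r0 (psnD (psn_sqrt_iter k.+1) (psn_sqrt_iter k)) IH).
move=> h; apply: psn_weaken (psn_eq _ h).
  rewrite normrN ger0_norm ?invr_ge0// exprS invfM; set q := (_ ^+ _)^-1; lra.
move=> x _ /=; move: (sqrt_iter k x) => v; ring.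
Qed.

Lemma psn_sqrt_near1 : psn p r (1 / 2 + 1 / 2) (fun x => Num.sqrt (1 + g x) - 1).
Proof.
apply: (psn_series (C := 1 / 2) (f := fun k x => sqrt_iter k.+1 x + -1 * sqrt_iter k x) r0).
- lra.
- exact: psn_sqrt_iter_diff.
move=> x xr; have gb := psn_bound hg xr.
have bk k := psn_bound (psn_sqrt_iter_diff k) xr.
have hC : 0 <= 1 / 2 :> R by lra.
apply: (has_sum_nat_geometric (C := 1 / 2) (abs_le_nat_geometric hC bk)) => N.
have -> : \sum_(k < N) (sqrt_iter k.+1 x + -1 * sqrt_iter k x) = sqrt_iter N x.
  elim: N => [|N IH]; first by rewrite big_ord0.
  by rewrite big_ord_recr IH /= !mulN1r addrC subrK.
set u := Num.sqrt (1 + g x) - 1.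
have [g1 g2] : - (3/4) <= g x /\ g x <= 3/4 by move: gb; rewrite ler_norml => /andP[]; lra.
have s2 : Num.sqrt (1 + g x) ^+ 2 = 1 + g x by rewrite sqr_sqrtr; lra.
have s0 := sqrtr_ge0 (1 + g x).
(* As [1 + g x >= 1/4], its root is at least 1/2; so the exact solution lies in the interval on
   which the iteration contracts. *)
have [u1 u2] : - (1/2) <= u /\ u <= 1/2.
  by rewrite /u; split; [|]; move: s2 s0; set s := Num.sqrt _ => s2 s0; nra.
have hu : u = 2^-1 * (g x + -1 * (u * u)).
  by rewrite (_ : g x = Num.sqrt (1 + g x) ^+ 2 - 1); [rewrite /u; field|rewrite s2; ring].
elim: N => [|N IH].
  by rewrite expr0 divr1 sub0r normrN ler_norml; apply/andP; split; lra.
rewrite {1}hu /= (_ : _ - _ = - 2^-1 * (sqrt_iter N x + u) * (sqrt_iter N x - u)); last by ring.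
rewrite exprS invfM mulrCA normrM; apply: ler_pM => //.
rewrite normrM normrN (ger0_norm (_ : 0 <= 2^-1)) ?invr_ge0//.
rewrite -[leRHS]mulr1 ler_wpM2l ?invr_ge0//.
have := psn_bound (psn_sqrt_iter N) xr.
by rewrite !ler_norml => /andP[h1 h2]; apply/andP; split; lra.
Qed.

End SquareRootSeries.

(** Compared with [analytic_at], a bound on the coefficient norm is kept, which products and
    iterated series rely on. *)
Definition ana p f := exists r K, 0 < r /\ psn p r K f.

Lemma ana_analytic_at p f : ana p f -> analytic_at f p.
Proof. by move=> [r [K [r0 [c [_ h]]]]]; exists r, c. Qed.

Lemma ana_common p f g : ana p f -> ana p g ->
  exists r K L, [/\ 0 < r, psn p r K f & psn p r L g].
Proof.
move=> [r [K [r0 hf]]] [s [L [s0 hg]]]; exists (Num.min r s), K, L.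
have m0 : 0 < Num.min r s by rewrite lt_min r0.
split=> //; [apply: psn_shrink hf|apply: psn_shrink hg]; rewrite ?(ltW m0)//;
  by rewrite ge_min lexx ?orbT.
Qed.

Lemma ana_ext p f g : f =1 g -> ana p f -> ana p g.
Proof. by move=> /funext ->. Qed.

Lemma ana_const p c : ana p (fun=> c).
Proof. by exists 1, `|c|; split=> //; exact: psn_const. Qed.

Lemma anaD p f g : ana p f -> ana p g -> ana p (fun x => f x + g x).
Proof.
move=> hf /(ana_common hf)[r [K [L [r0 h1 h2]]]].
by exists r, (K + L); split=> //; exact: psnD.
Qed.

Lemma anaM p f g : ana p f -> ana p g -> ana p (fun x => f x * g x).
Proof.
move=> hf /(ana_common hf)[r [K [L [r0 h1 h2]]]].
by exists r, (K * L); split=> //; exact: psnM.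
Qed.

Lemma ana_coord p i : ana p (fun x => x i).
Proof.
apply: (@ana_ext _ (fun x => (x i - p i) + p i)); first by move=> x; rewrite subrK.
by apply: anaD (ana_const _ _); exists 1, 1; split=> //; exact: psn_coord.
Qed.

Lemma anaN p f : ana p f -> ana p (fun x => - f x).
Proof.
move=> hf; apply: ana_ext (anaM (ana_const p (-1)) hf) => x.
by rewrite mulN1r.
Qed.

Lemma anaB p f g : ana p f -> ana p g -> ana p (fun x => f x - g x).
Proof. by move=> hf hg; apply: anaD hf (anaN hg). Qed.

Lemma anaX p f k : ana p f -> ana p (fun x => f x ^+ k).
Proof.
move=> hf; elim: k => [|k IH]; first exact: ana_const.
by apply: ana_ext (anaM hf IH) => x; rewrite exprS.
Qed.

Lemma ana_sum (T : Type) (s : seq T) (P : pred T) (F : T -> (I -> R) -> R) p :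
  (forall t, P t -> ana p (F t)) -> ana p (fun x => \sum_(t <- s | P t) F t x).
Proof.
move=> h; elim: s => [|t s IH].
  by apply: ana_ext (ana_const p 0) => x; rewrite big_nil.
case: (boolP (P t)) => Pt.
  by apply: ana_ext (anaD (h t Pt) IH) => x; rewrite big_cons Pt.
by apply: ana_ext IH => x; rewrite big_cons (negbTE Pt).
Qed.

Lemma ana_small p f e : ana p f -> 0 < e ->
  exists2 r, 0 < r & psn p r e (fun x => f x - f p).
Proof. by move=> [r [K [r0 hf]]] e0; exact: psn_vanish hf. Qed.

(** After division by [f p] the function is [1 - g] with [g p = 0], and [g] has norm at most 1/2 on
    a small polydisc. The square root is normalized in the same way. *)
Lemma anaV p f : f p != 0 -> ana p f -> ana p (fun x => (f x)^-1).
Proof.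
move=> fp hf; have h := anaM (ana_const p (- (f p)^-1)) hf.
have e0 : 0 < 1 / 2 :> R by lra.
have [r r0 hr] := ana_small h e0.
have : ana p (fun x => (1 - (- (f p)^-1 * f x - - (f p)^-1 * f p))^-1).
  by exists r, (1 + 1); split=> //; exact: psn_inv_near1.
move=> /(anaM (ana_const p (f p)^-1)); apply: ana_ext => x.
rewrite -invfM; congr (_^-1); field; exact: fp.
Qed.

Lemma ana_sqrt p f : 0 < f p -> ana p f -> ana p (fun x => Num.sqrt (f x)).
Proof.
move=> fp hf; have h := anaM (ana_const p (f p)^-1) hf.
have e0 : 0 < 3 / 4 :> R by lra.
have [r r0 hr] := ana_small h e0.
have : ana p (fun x => Num.sqrt (1 + ((f p)^-1 * f x - (f p)^-1 * f p)) - 1).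
  by exists r, (1 / 2 + 1 / 2); split=> //; exact: psn_sqrt_near1.
move=> /(fun h => anaD h (ana_const p 1)).
move=> /(anaM (ana_const p (Num.sqrt (f p)))); apply: ana_ext => x.
rewrite subrK -sqrtrM ?(ltW fp)//; congr Num.sqrt.
by field; rewrite gt_eqF.
Qed.

End AnalyticClosure.

(** * Euclidean geometry behind the rigidity of the gadgets *)

Section DotProduct.
Variables (R : realType) (n : nat).
Local Notation vec := 'rV[R]_n.
Implicit Types u v w : vec.

Definition dot u v : R := \sum_k u 0 k * v 0 k.
Definition sqn u : R := dot u u.
Definition unitv (k : 'I_n) : vec := delta_mx 0 k.

Lemma dotC u v : dot u v = dot v u.
Proof. by apply: eq_bigr => k _; rewrite mulrC. Qed.

Lemma dotDl u v w : dot (u + v) w = dot u w + dot v w.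
Proof. by rewrite -big_split; apply: eq_bigr => k _; rewrite mxE mulrDl. Qed.

Lemma dotZl a u w : dot (a *: u) w = a * dot u w.
Proof. by rewrite mulr_sumr; apply: eq_bigr => k _; rewrite mxE mulrA. Qed.

Lemma dotDr u v w : dot w (u + v) = dot w u + dot w v.
Proof. by rewrite !(dotC w) dotDl. Qed.

Lemma dotZr a u w : dot w (a *: u) = a * dot w u.
Proof. by rewrite !(dotC w) dotZl. Qed.

Lemma dotNl u w : dot (- u) w = - dot u w.
Proof. by rewrite -scaleN1r dotZl mulN1r. Qed.

Lemma dotNr u w : dot w (- u) = - dot w u.
Proof. by rewrite !(dotC w) dotNl. Qed.

Lemma dot_unitr u k : dot u (unitv k) = u 0 k.
Proof.
rewrite /dot (bigD1 k)//= big1 => [|l lk]; rewrite !mxE.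
  by rewrite !eqxx mulr1 addr0.
by rewrite (negbTE lk) andbF mulr0.
Qed.

Definition dotE := (dotDl, dotDr, dotNl, dotNr, dotZl, dotZr).

Lemma sqn_ge0 u : 0 <= sqn u.
Proof. by apply: sumr_ge0 => k _; rewrite -expr2 sqr_ge0. Qed.

Lemma sqn_eq0 u : sqn u = 0 -> u = 0.
Proof.
move=> /eqP; rewrite psumr_eq0 => [/allP h|k _]; last by rewrite -expr2 sqr_ge0.
apply/rowP => k; have := h k; rewrite mem_index_enum => /(_ isT)/=.
by rewrite mulf_eq0 orbb => /eqP ->; rewrite mxE.
Qed.

Lemma sqn_unit k : sqn (unitv k) = 1.
Proof. by rewrite /sqn dot_unitr !mxE !eqxx. Qed.

Lemma coord_sqr_le u k : u 0 k ^+ 2 <= sqn u.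
Proof.
rewrite /sqn /dot (bigD1 k)//= expr2 lerDl; apply: sumr_ge0 => l _.
by rewrite -expr2 sqr_ge0.
Qed.

Lemma sqnD_le u v : sqn (u + v) <= 2 * (sqn u + sqn v).
Proof.
have := sqn_ge0 (u - v); rewrite /sqn !dotE (dotC v u); lra.
Qed.

Lemma sqnZ a u : sqn (a *: u) = a ^+ 2 * sqn u.
Proof. by rewrite /sqn !dotE mulrA. Qed.

Lemma sqnD u v : sqn (u + v) = sqn u + 2 * dot u v + sqn v.
Proof. by rewrite /sqn !dotE (dotC v u); ring. Qed.

Lemma sqnB_sym u v : sqn (u - v) = sqn (v - u).
Proof. by rewrite /sqn !dotE; ring. Qed.

(** Stewart's identity: [(1 - l) |p - a|^2 + l |p - b|^2] exceeds the squared distance of [p] from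
    the point [a + l (b - a)] by [l (1 - l) s]. It holds for every real [l], so the point may lie
    outside the segment. *)
Lemma ext_rigid (a b p : vec) (l s : R) : sqn (b - a) = s ->
  (sqn (p - a) = l ^+ 2 * s /\ sqn (p - b) = (1 - l) ^+ 2 * s) <->
  p = a + l *: (b - a).
Proof.
move=> <-; split=> [[h1 h2]|->]; last first.
  rewrite /sqn !dotE (dotC b a); split; ring.
apply/eqP; rewrite -subr_eq0; apply/eqP/sqn_eq0.
move: h1 h2; rewrite /sqn !dotE (dotC b a) (dotC p a) (dotC p b) => h1 h2.
have := congr1 (fun z => (1 - l) * z) h1; have := congr1 (fun z => l * z) h2.
lra.
Qed.

(* [w], [w + x / 2] and [w + x] have equal norms, which forces [x = 0] by strict
   convexity. *)
Lemma par_rigid (a b c p N : vec) (s t : R) :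
  sqn (b - a) = s -> sqn (c - a) = t ->
  [/\ sqn (p - b) = t, sqn (p - c) = s, sqn (N - c) = 2^-1 ^+ 2 * s,
      sqn (N - p) = (1 - 2^-1) ^+ 2 * s &
      sqn (N - (a + 2^-1 *: (b - a))) = t] <->
  p = b + c - a /\ N = c + 2^-1 *: (b - a).
Proof.
move=> hs ht; split=> [[h1 h2 h3 h4 h5]|[-> ->]]; last first.
  move: hs ht; rewrite /sqn !dotE (dotC b a) (dotC c a) (dotC c b) => <- <-.
  by split; field.
have hN : N = c + 2^-1 *: (p - c) by apply/(ext_rigid N 2^-1 h2).
have hp : p = b + c - a.
  have [x hx] : exists x, p = x + (b + c - a) by exists (p - (b + c - a)); rewrite subrK.
  move: h1 h5; rewrite -ht hN hx => h1 h5.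
  have e1 : sqn (x + (b + c - a) - b) = sqn x + 2 * dot x (c - a) + sqn (c - a).
    by rewrite (_ : _ - b = x + (c - a)) ?sqnD//; apply/rowP => k; rewrite !mxE; ring.
  have e2 : sqn (c + 2^-1 *: (x + (b + c - a) - c) - (a + 2^-1 *: (b - a))) =
      4^-1 * sqn x + dot x (c - a) + sqn (c - a).
    rewrite (_ : _ - (a + _) = 2^-1 *: x + (c - a)) ?sqnD ?sqnZ ?dotZl; first by field.
    by apply/rowP => k; rewrite !mxE; field.
  have /sqn_eq0 -> : sqn x = 0 by move: h1 h5; rewrite e1 e2; lra.
  by rewrite add0r.
by split=> //; rewrite hN hp; apply/rowP => k; rewrite !mxE; ring.
Qed.

(* The half circle [S >= 0] meets the line [a C + b S = m] exactly once, because
   its end points [(1, 0)] and [(-1, 0)] lie on different sides. *)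
Lemma half_circle_line (a b m C S : R) : `|m| < a ->
  let N := a ^+ 2 + b ^+ 2 in let w := Num.sqrt (N - m ^+ 2) in
  [/\ C ^+ 2 + S ^+ 2 = 1, a * C + b * S = m & 0 <= S] <->
  C = (m * a - b * w) / N /\ S = (m * b + a * w) / N.
Proof.
move=> ma N w; have a0 : 0 < a by apply: le_lt_trans ma; exact: normr_ge0.
have N0 : 0 < N by rewrite ltr_wpDr ?sqr_ge0// exprn_gt0.
have m2 : m ^+ 2 < a ^+ 2.
  by rewrite -real_normK ?num_real// ltrXn2r ?nnegrE// ltW.
have w2 : w ^+ 2 = N - m ^+ 2.
  by rewrite /w sqr_sqrtr// subr_ge0 (le_trans (ltW m2))// lerDl sqr_ge0.
have w0 : 0 <= w by exact: sqrtr_ge0.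
(* [(a w)^2 - (m b)^2 = (a^2 - m^2) N] is positive, so [m b + a w] and [m b - a w] have opposite
   signs, and exactly one of the two intersections with the circle satisfies [S >= 0]. *)
have key : m * b < a * w.
  rewrite ltNge; apply/negP => h.
  have aw : 0 <= a * w by rewrite mulr_ge0// ltW.
  have : (a * w) ^+ 2 <= (m * b) ^+ 2 by rewrite lerXn2r ?nnegrE// (le_trans aw).
  rewrite !exprMn w2 /N => h2.
  have h3 : m ^+ 2 * b ^+ 2 <= a ^+ 2 * b ^+ 2 by rewrite ler_wpM2r ?sqr_ge0// ltW.
  have h4 : 0 < a ^+ 2 * (a ^+ 2 - m ^+ 2) by rewrite mulr_gt0 ?exprn_gt0// subr_gt0.
  nra.
have key' : - (m * b) < a * w.
  rewrite ltNge; apply/negP => h.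
  have aw : 0 <= a * w by rewrite mulr_ge0// ltW.
  have : (a * w) ^+ 2 <= (- (m * b)) ^+ 2 by rewrite lerXn2r ?nnegrE// (le_trans aw).
  rewrite sqrrN !exprMn w2 /N => h2.
  have h3 : m ^+ 2 * b ^+ 2 <= a ^+ 2 * b ^+ 2 by rewrite ler_wpM2r ?sqr_ge0// ltW.
  have h4 : 0 < a ^+ 2 * (a ^+ 2 - m ^+ 2) by rewrite mulr_gt0 ?exprn_gt0// subr_gt0.
  nra.
have Nn : N != 0 by rewrite gt_eqF.
split=> [[h1 h2 h3]|[-> ->]].
  (* [t] is the component orthogonal to the constraint: Lagrange's identity gives [m^2 + t^2 = N],
     so [t] is [w] or [- w]. *)
  pose t := a * S - b * C.
  have t2 : t ^+ 2 = w ^+ 2.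
    rewrite w2 -h2 -[N]mulr1 -h1 /t /N; ring.
  have hC : C = (m * a - b * t) / N by apply: (mulIf Nn); rewrite divfK// -h2 /t /N; ring.
  have hS : S = (m * b + a * t) / N by apply: (mulIf Nn); rewrite divfK// -h2 /t /N; ring.
  have : t = w \/ t = - w.
    by move/eqP: t2; rewrite eqf_sqr => /orP[] /eqP; [left|right].
  case=> tw; first by rewrite -tw.
  move: h3; rewrite hS tw pmulr_lge0 ?invr_gt0//; lra.
split.
- have -> : ((m * a - b * w) / N) ^+ 2 + ((m * b + a * w) / N) ^+ 2 =
    (m ^+ 2 + w ^+ 2) * (a ^+ 2 + b ^+ 2) / N ^+ 2 by field.
  by rewrite w2 -/N; field.
- by apply: (mulIf Nn); rewrite mulrDl !mulrA !divfK// /N; ring.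
- by rewrite divr_ge0 ?(ltW N0)//; lra.
Qed.

End DotProduct.

(** * Systems of distance constraints over an arbitrary vertex type *)

Section Constraints.
Variables (R : realType) (n : nat).
Local Notation vec := 'rV[R]_n.

(* Lengths are squared. *)
Inductive constr (T : Type) : Type :=
  | Fix of T & vec
  | Rod of T & T & R
  | Cable of T & T & R.

Definition holds T (phi : T -> vec) (c : constr T) : Prop :=
  match c with
  | Fix v u => phi v = u
  | Rod v w s => sqn (phi v - phi w) = s
  | Cable v w s => sqn (phi v - phi w) <= s
  end.

(** Renumbering serves twice: to plug a gadget into a growing circuit, whose vertices are natural
    numbers, and to pass to the finite vertex set of the final linkage. *)
Definition cmap T T' (f : T -> T') (c : constr T) : constr T' :=
  match c with
  | Fix v u => Fix (f v) u
  | Rod v w s => Rod (f v) (f w) s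
  | Cable v w s => Cable (f v) (f w) s
  end.

Definition cwf (m : nat) (c : constr nat) : Prop :=
  match c with
  | Fix v u => (v < m)%N
  | Rod v w s => [/\ (v < m)%N, (w < m)%N & 0 < s]
  | Cable v w s => [/\ (v < m)%N, (w < m)%N & 0 < s]
  end.

Fixpoint every (T : Type) (P : T -> Prop) (s : seq T) : Prop :=
  if s is x :: s' then P x /\ every P s' else True.

Lemma every_cat T (P : T -> Prop) s t : every P (s ++ t) <-> every P s /\ every P t.
Proof. by elim: s => [|x s IH] /=; tauto. Qed.

Lemma every_map T T' (f : T -> T') (P : T' -> Prop) s :
  every P (map f s) <-> every (fun x => P (f x)) s.
Proof. by elim: s => [|x s IH] /=; tauto. Qed.

Lemma every_imp T (P Q : T -> Prop) s :
  (forall x, P x -> Q x) -> every P s -> every Q s.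
Proof. by move=> PQ; elim: s => [|x s IH] //= [/PQ ? /IH]. Qed.

Lemma everyP (T : eqType) (P : T -> Prop) (s : seq T) :
  every P s <-> forall x, x \in s -> P x.
Proof.
elim: s => [|y s IH] //=; split=> [[Py /IH h] x|h].
  by rewrite inE => /orP[/eqP ->|/h].
by split; [apply: h; rewrite mem_head|apply/IH => x xs; apply: h; rewrite inE xs orbT].
Qed.

Lemma every_nth T x0 (P : T -> Prop) s :
  every P s <-> forall i, (i < size s)%N -> P (nth x0 s i).
Proof.
elim: s => [|y s IH] //=; split=> [[Py /IH h] [|i]//|h]; first exact: h.
by split; [exact: (h 0%N)|apply/IH => i; exact: (h i.+1)].
Qed.

Definition sat T (phi : T -> vec) cs := every (holds phi) cs.

Lemma sat_cmap T T' (f : T -> T') phi cs :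
  sat phi (map (cmap f) cs) <-> sat (phi \o f) cs.
Proof. by rewrite /sat every_map; split; apply: every_imp => -[]. Qed.

Lemma sat_local m (phi psi : nat -> vec) cs :
  (forall v, (v < m)%N -> phi v = psi v) -> every (cwf m) cs ->
  sat phi cs <-> sat psi cs.
Proof.
move=> e; elim: cs => [|c cs IH] //= [hc /IH {}IH].
suff h : holds phi c <-> holds psi c by move: IH; rewrite /sat /=; tauto.
by case: c hc => /= [v u vm|v w s [vm wm _]|v w s [vm wm _]]; rewrite !e.
Qed.

Lemma cwf_weaken m m' c : (m <= m')%N -> cwf m c -> cwf m' c.
Proof.
by move=> mm; case: c => [v u|v w s|v w s] /=; [|case|case] => *; try split;
  try apply: leq_trans mm.
Qed.

End Constraints.

(** * Computable functions and the composition of gadgets *)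

Section Computable.
Variables (R : realType) (n j : nat) (B : R).
Local Notation vec := 'rV[R]_n.
Local Notation input := ('I_j * 'I_n -> R).
Implicit Types (x : input) (f g : input -> vec) (fs gs : seq (input -> vec)).

Definition inbox x := forall q, `|x q| < B.

Definition inputv x : seq vec := [seq \row_i x (a, i) | a <- enum 'I_j].

Definition values fs x : seq vec := [seq f x | f <- fs].

Definition vana f := forall p, inbox p -> forall k, ana p (fun x => f x 0 k).

Definition vbounded f := exists M, forall x, inbox x -> sqn (f x) <= M.

Definition vgood f := vana f /\ vbounded f.

(* The vertices [0 .. j - 1] are the inputs, the following ones are forced to
   the positions [fs]. *)
Definition circuit fs := every vana fs /\ exists sys,
  every (cwf (j + size fs)) sys /\ forall x, inbox x ->
    forall ws, size ws = size fs ->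
      sat (nth 0 (inputv x ++ ws)) sys <-> ws = values fs x.

Definition available f fs := exists2 k, (k < j + size fs)%N &
  forall x, inbox x -> nth 0 (inputv x ++ values fs x) k = f x.

(* Quantifying over all circuits makes computable functions composable without
   any bookkeeping of vertex numbers. *)
Definition computable f := vgood f /\
  forall fs, circuit fs -> exists gs, circuit (fs ++ gs) /\ available f (fs ++ gs).

Lemma size_inputv x : size (inputv x) = j.
Proof. by rewrite size_map size_enum_ord. Qed.

Lemma values_cat fs gs x : values (fs ++ gs) x = values fs x ++ values gs x.
Proof. exact: map_cat. Qed.

Lemma size_values fs x : size (values fs x) = size fs.
Proof. exact: size_map. Qed.

Lemma circuit_nil : circuit [::].
Proof. by split=> //; exists [::]; split=> // x _ [|]. Qed.

Lemma nth_inputv_cat fs gs x k : (k < j + size fs)%N ->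
  nth 0 (inputv x ++ values (fs ++ gs) x) k = nth 0 (inputv x ++ values fs x) k.
Proof.
by move=> kfs; rewrite values_cat catA nth_cat size_cat size_inputv size_values kfs.
Qed.

Lemma available_all fs args : circuit fs -> every computable args ->
  exists gs ks, [/\ circuit (fs ++ gs), size ks = size args,
    forall i, (i < size args)%N -> (nth 0%N ks i < j + size (fs ++ gs))%N &
    forall x, inbox x -> forall i, (i < size args)%N ->
      nth 0 (inputv x ++ values (fs ++ gs) x) (nth 0%N ks i) = nth 0 (values args x) i].
Proof.
elim: args fs => [|f args IH] fs hfs /= => [_|[[_ hf] /IH {}IH]].
  by exists [::], [::]; rewrite cats0; split.
have [gs [/IH[gs' [ks [h1 h2 h3 h4]]] [k k1 k2]]] := hf _ hfs.
have kl : (k < j + size (fs ++ gs ++ gs'))%N.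
  by rewrite catA size_cat addnA ltn_addr.
exists (gs ++ gs'), (k :: ks); rewrite catA; split=> //=; first by rewrite h2.
  move=> [|i] ilt /=; first by rewrite -catA.
  exact: h3.
move=> x xB [|i] ilt /=; first by rewrite nth_inputv_cat// k2.
exact: h4.
Qed.

(** The rule by which every gadget enters. In the local numbering of [cs] the arguments come first,
    then the new vertices [gs]; the first of these is the output [f], the others are auxiliary. The
    constraints need to determine [gs] only when the arguments have their correct values. *)
Lemma computable_prim args f gs' (cs : seq (constr R n nat)) (gs := f :: gs') :
  every computable args -> every vgood gs ->
  every (cwf (size args + size gs)) cs ->
  (forall x, inbox x -> forall ws, size ws = size gs ->
     sat (nth 0 (values args x ++ ws)) cs <-> ws = values gs x) ->
  computable f.
Proof.
move=> hargs hgs wfcs hcs; split; first by case: hgs.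
move=> fs /available_all/(_ hargs)[hs [ks [[ana_h [sys [wfs hsys]]] sz_ks ks_lt hks]]].
set fs' := fs ++ hs in ana_h wfs hsys ks_lt hks.
exists (hs ++ gs); rewrite catA -/fs'; clearbody fs'.
(* Arguments are sent to the vertices where they are already available, new vertices are appended to
   the circuit. *)
pose rho v := if (v < size args)%N then nth 0%N ks v else (j + size fs' + (v - size args))%N.
split; last first.
  exists (j + size fs')%N => [|x xB]; first by rewrite size_cat addnA /= addnS ltnS leq_addr.
  by rewrite values_cat catA nth_cat size_cat size_inputv size_values ltnn subnn.
split; first by apply/every_cat; split=> //; apply: every_imp hgs => g [].
exists (sys ++ map (cmap rho) cs); split.
  apply/every_cat; split.
    apply: every_imp wfs => c; apply: cwf_weaken.
    by rewrite size_cat addnA leq_addr.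
  apply/every_map; apply: every_imp wfcs => c.
  have rho_lt v : (v < size args + size gs)%N -> (rho v < j + size (fs' ++ gs))%N.
    rewrite /rho size_cat addnA; case: (ltnP v (size args)) => [va _|va vg].
      by apply: ltn_addr; exact: ks_lt.
    by rewrite ltn_add2l ltn_subLR.
  by case: c => [v u|v w s|v w s] /=; [|case|case] => *; try split; try exact: rho_lt.
move=> x xB ws; rewrite size_cat => sws.
pose ws1 := take (size fs') ws; pose ws2 := drop (size fs') ws.
have s1 : size ws1 = size fs' by rewrite size_takel// sws leq_addr.
have s2 : size ws2 = size gs by rewrite size_drop sws addKn.
have -> : ws = ws1 ++ ws2 by rewrite cat_take_drop.
rewrite /sat every_cat.
have e1 : every (holds (nth 0 (inputv x ++ ws1 ++ ws2))) sys <-> ws1 = values fs' x.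
  rewrite -(hsys x xB ws1 s1); apply: (sat_local (m := j + size fs')) => // v vlt.
  by rewrite catA nth_cat size_cat size_inputv s1 vlt.
have e2 : ws1 = values fs' x ->
    every (holds (nth 0 (inputv x ++ ws1 ++ ws2))) (map (cmap rho) cs) <-> ws2 = values gs x.
  move=> w1; rewrite -(hcs x xB ws2 s2) -[every _ _]/(sat _ _) sat_cmap.
  apply: (sat_local (m := size args + size gs)) => // v vlt /=.
  rewrite /rho [RHS]nth_cat size_values; case: (ltnP v (size args)) => va.
    rewrite -hks// catA nth_cat size_cat size_inputv s1.
    by rewrite (ks_lt _ va) w1.
  rewrite catA nth_cat size_cat size_inputv s1 ltnNge leq_addr/=.
  by rewrite addKn.
rewrite values_cat; split=> [[/e1 w1 /(e2 w1) ->]|]; first by rewrite w1.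
move=> /eqP; rewrite eqseq_cat ?size_values// => /andP[/eqP w1 /eqP w2].
by split; [apply/e1|apply/(e2 w1)].
Qed.

Lemma computable_good f : computable f -> vgood f.
Proof. by case. Qed.

Lemma computable_eq f g : (forall x, f x = g x) -> computable f -> computable g.
Proof. by move=> /funext ->. Qed.

Lemma computable_input (a : 'I_j) : computable (fun x => \row_i x (a, i)).
Proof.
split; last first.
  move=> fs hfs; exists [::]; rewrite cats0; split=> //; exists (nat_of_ord a) => [|x _].
    exact: ltn_addr (ltn_ord a).
  rewrite nth_cat size_inputv ltn_ord (nth_map a) ?size_enum_ord//.
  by apply/rowP => i; rewrite !mxE nth_ord_enum.
split=> [p _ k|].
  by apply: ana_ext (ana_coord p (a, k)) => x; rewrite mxE.
exists (\sum_(i < n) B ^+ 2) => x xB; apply: ler_sum => i _; rewrite !mxE -expr2.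
have xb := ltW (xB (a, i)).
by rewrite -real_normK ?num_real// lerXn2r ?nnegrE// (le_trans _ xb).
Qed.

Lemma vgood_const (c : vec) : vgood (fun=> c).
Proof. by split=> [p _ k|]; [exact: ana_const|exists (sqn c)]. Qed.

Lemma vgoodD f g : vgood f -> vgood g -> vgood (fun x => f x + g x).
Proof.
move=> [af [M hM]] [ag [N hN]]; split=> [p pB k|].
  by apply: ana_ext (anaD (af p pB k) (ag p pB k)) => x; rewrite mxE.
exists (2 * (M + N)) => x xB; apply: (le_trans (sqnD_le _ _)).
by have := hM x xB; have := hN x xB; lra.
Qed.

Lemma vgoodZ a f : vgood f -> vgood (fun x => a *: f x).
Proof.
move=> [af [M hM]]; split=> [p pB k|].
  by apply: ana_ext (anaM (ana_const p a) (af p pB k)) => x; rewrite mxE.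
exists (a ^+ 2 * M) => x xB; rewrite sqnZ ler_wpM2l ?sqr_ge0//; exact: hM.
Qed.

Lemma vgood_eq f g : (forall x, f x = g x) -> vgood f -> vgood g.
Proof. by move=> /funext ->. Qed.

Lemma vgoodB f g : vgood f -> vgood g -> vgood (fun x => f x - g x).
Proof.
move=> hf hg; apply: vgood_eq (vgoodD hf (vgoodZ (-1) hg)) => x.
by rewrite scaleN1r.
Qed.

Lemma computable_const (c : vec) : computable (fun=> c).
Proof.
apply: (@computable_prim [::] (fun=> c) [::] [:: Fix 0%N c]) => //=.
  by split=> //; exact: vgood_const.
move=> x _ [|w [|]]//= _; rewrite /sat /=.
by split=> [[->]|[->]].
Qed.

Lemma computable_extend f g l s : computable f -> computable g -> 0 < s ->
  (forall x, inbox x -> sqn (g x - f x) = s) ->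
  computable (fun x => f x + l *: (g x - f x)).
Proof.
move=> hf hg s0 hs.
(* For [l = 0] or [l = 1] one of the two rods would have length zero, which a linkage does not
   allow; the point is then already available. *)
have [->|l0] := eqVneq l 0.
  by apply: computable_eq hf => x; rewrite scale0r addr0.
have [->|l1] := eqVneq l 1.
  by apply: computable_eq hg => x; rewrite scale1r addrC subrK.
have gf := computable_good hf; have gg := computable_good hg.
apply: (@computable_prim [:: f; g] (fun x => f x + l *: (g x - f x)) [::]
  [:: Rod n 2 0 (l ^+ 2 * s); Rod n 2 1 ((1 - l) ^+ 2 * s)]%N) => //=.
- by split=> //; apply: vgoodD gf (vgoodZ l (vgoodB gg gf)).
- have l1' : 1 - l != 0 by rewrite subr_eq0 eq_sym.
  by do !split; rewrite // mulr_gt0// exprn_even_gt0.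
move=> x xB [|w [|]]//= _; rewrite /sat /=.
have := ext_rigid w l (hs x xB) => h.
split=> [[h1 [h2 _]]|[w0]]; first by rewrite (proj1 h).
by have [h1 h2] := proj2 h w0.
Qed.

Lemma computable_par f g h s t : computable f -> computable g -> computable h ->
  0 < s -> 0 < t ->
  (forall x, inbox x -> sqn (g x - f x) = s) ->
  (forall x, inbox x -> sqn (h x - f x) = t) ->
  computable (fun x => g x + h x - f x).
Proof.
move=> hf hg hh s0 t0 hs ht.
have hm := computable_extend 2^-1 hf hg s0 hs.
have gf := computable_good hf; have gg := computable_good hg; have gh := computable_good hh.
have s4 : 0 < 2^-1 ^+ 2 * s by rewrite mulr_gt0// exprn_gt0// invr_gt0.
have s4' : 0 < (1 - 2^-1) ^+ 2 * s by rewrite mulr_gt0// exprn_gt0//; lra.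
(* Vertices 0 to 2 are [f], [g], [h], vertex 3 is the midpoint of [f] and [g], vertex 4 the fourth
   corner, and vertex 5 the midpoint of corners 2 and 4. The rod from 5 to 3 is the brace. *)
apply: (@computable_prim [:: f; g; h; fun x => f x + 2^-1 *: (g x - f x)]
  (fun x => g x + h x - f x) [:: fun x => h x + 2^-1 *: (g x - f x)]
  [:: Rod n 4 1 t; Rod n 4 2 s; Rod n 5 2 (2^-1 ^+ 2 * s);
      Rod n 5 4 ((1 - 2^-1) ^+ 2 * s); Rod n 5 3 t]%N) => //=.
  split; first exact: vgoodB (vgoodD gg gh) gf.
  by split=> //; exact: vgoodD gh (vgoodZ _ (vgoodB gg gf)).
move=> x xB [|p [|N [|]]]//= _; rewrite /sat /=.
have k := par_rigid p N (hs x xB) (ht x xB).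
split=> [[h1 [h2 [h3 [h4 [h5 _]]]]]|[p0 N0]].
  by have [|-> ->] := proj1 k.
by have [? ? ? ? ?] := proj2 k (conj p0 N0).
Qed.

End Computable.

(** * The elbow gadget *)

Section Plane.
Variables (R : realType) (n : nat) (o i : 'I_n).
Hypothesis oi : o != i.
Local Notation vec := 'rV[R]_n.

Definition plane (a b : R) : vec := a *: unitv R o + b *: unitv R i.

Lemma plane_o a b : plane a b 0 o = a.
Proof. by rewrite !mxE !eqxx (negbTE oi) mulr1 mulr0 addr0. Qed.

Lemma plane_i a b : plane a b 0 i = b.
Proof. by rewrite !mxE !eqxx eq_sym (negbTE oi) mulr1 mulr0 add0r. Qed.

Lemma plane_other a b k : k != o -> k != i -> plane a b 0 k = 0.
Proof. by move=> /negbTE ko /negbTE ki; rewrite !mxE ko ki !andbF !mulr0 addr0. Qed.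

Lemma dot_plane a b v : dot (plane a b) v = a * v 0 o + b * v 0 i.
Proof. by rewrite dotDl !dotZl !(dotC _ v) !dot_unitr. Qed.

Lemma sqn_plane a b : sqn (plane a b) = a ^+ 2 + b ^+ 2.
Proof. by rewrite /sqn dot_plane plane_o plane_i !expr2. Qed.

Lemma planeD a b a' b' : plane a b + plane a' b' = plane (a + a') (b + b').
Proof. by rewrite /plane !scalerDl addrACA. Qed.

Lemma planeZ k a b : k *: plane a b = plane (k * a) (k * b).
Proof. by rewrite /plane scalerDr !scalerA. Qed.

(* An elbow [c + v] between a shoulder [c] and a hand [c + d], with upper arm of
   length [L] and forearm of squared length [l2], satisfies
   [dot v d = L * elbow_m L l2 d]; [sg] selects one of its two positions in the
   plane of the axes [o] and [i]. *)
Definition elbow_m (L l2 : R) (d : vec) := (sqn d + L ^+ 2 - l2) / (2 * L).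
Definition elbow_N (sg : R) (d : vec) := d 0 o ^+ 2 + (sg * d 0 i) ^+ 2.
Definition elbow_w L l2 sg d := Num.sqrt (elbow_N sg d - elbow_m L l2 d ^+ 2).
(** [L] times the point given by [half_circle_line] for [a = d 0 o], [b = sg * d 0 i] and
    [m = elbow_m L l2 d]; the outer factor [sg] undoes the reflection of the second coordinate. *)
Definition elbow_dir L l2 sg d : vec :=
  plane (L * ((elbow_m L l2 d * d 0 o - sg * d 0 i * elbow_w L l2 sg d) / elbow_N sg d))
        (L * sg * ((elbow_m L l2 d * (sg * d 0 i) + d 0 o * elbow_w L l2 sg d) / elbow_N sg d)).

Variables (L l2 sg : R) (c f : vec).
Hypotheses (L0 : 0 < L) (sg1 : sg ^+ 2 = 1).
Let d := f - c.
Hypothesis md : `|elbow_m L l2 d| < d 0 o.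

Lemma elbow_N_gt0 : 0 < elbow_N sg d.
Proof.
rewrite ltr_wpDr ?sqr_ge0// exprn_gt0//.
exact: le_lt_trans (normr_ge0 _) md.
Qed.

Lemma elbow_disc_gt0 : 0 < elbow_N sg d - elbow_m L l2 d ^+ 2.
Proof.
rewrite subr_gt0 ltr_wpDr ?sqr_ge0//.
rewrite -(real_normK (num_real (elbow_m _ _ _))) ltrXn2r ?nnegrE//.
Qed.

(** Put [w = c + v] with [|v| = L]. By Pythagoras, distance [sqrt 2 * L] from [c + L e_k] means
    [v_k = 0], so the rods keep [v] in the plane; likewise the cable means [sg * v_i >= 0]. What
    remains is a half circle, and the forearm cuts it with a line. *)
Lemma elbow_rigid (w : vec) :
  [/\ sqn (w - c) = L ^+ 2, sqn (w - f) = l2,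
      sqn (w - (c + (sg * L) *: unitv R i)) <= 2 * L ^+ 2 &
      forall k, k != o -> k != i -> sqn (w - (c + L *: unitv R k)) = 2 * L ^+ 2] <->
  w = c + elbow_dir L l2 sg d.
Proof.
have [v ->] : exists v, w = c + v by exists (w - c); rewrite addrC subrK.
have Ln : L != 0 by rewrite gt_eqF.
have ek k a : sqn (c + v - (c + a *: unitv R k)) = sqn v - 2 * a * v 0 k + a ^+ 2.
  have -> : c + v - (c + a *: unitv R k) = v + (- a) *: unitv R k.
    by apply/rowP => l; rewrite !mxE; ring.
  by rewrite sqnD sqnZ sqn_unit dotZr dot_unitr; ring.
have ec : sqn (c + v - c) = sqn v by rewrite addrC addKr.
have ef : sqn (c + v - f) = sqn v - 2 * dot v d + sqn d.
  have -> : c + v - f = v + -1 *: d by apply/rowP => l; rewrite !mxE; ring.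
  by rewrite sqnD sqnZ dotZr; ring.
have ss : (sg * L) ^+ 2 = L ^+ 2 by rewrite exprMn sg1 mul1r.
have hm : 2 * (elbow_m L l2 d * L) = sqn d + L ^+ 2 - l2 by rewrite /elbow_m; field.
have sgs : sg * sg = 1 by rewrite -expr2.
have line C S : [/\ C ^+ 2 + S ^+ 2 = 1,
      d 0 o * C + sg * d 0 i * S = elbow_m L l2 d & 0 <= S] <->
    C = (elbow_m L l2 d * d 0 o - sg * d 0 i * elbow_w L l2 sg d) / elbow_N sg d /\
    S = (elbow_m L l2 d * (sg * d 0 i) + d 0 o * elbow_w L l2 sg d) / elbow_N sg d.
  exact: half_circle_line.
rewrite ec ef ek ss; split=> [[h1 h2 h3 h4]|/addrI hv].
  have vp : v = plane (v 0 o) (v 0 i).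
    apply/rowP => k; have [->|ko] := eqVneq k o; first by rewrite plane_o.
    have [->|ki] := eqVneq k i; first by rewrite plane_i.
    rewrite plane_other//; have := h4 k ko ki; rewrite ek h1 => h.
    apply: (mulfI Ln); rewrite mulr0; lra.
  have hS : (v 0 o / L) ^+ 2 + (sg * v 0 i / L) ^+ 2 = 1.
    rewrite !expr_div_n exprMn sg1 mul1r -mulrDl -sqn_plane -vp h1 divff//.
    by rewrite expf_neq0.
  have hl : d 0 o * (v 0 o / L) + sg * d 0 i * (sg * v 0 i / L) = elbow_m L l2 d.
    apply: (mulIf Ln); have : dot v d = elbow_m L l2 d * L by lra.
    rewrite {1}vp dot_plane => <-.
    rewrite mulrDl !mulrA !divfK// -!mulrA (mulrCA (d 0 i)) (mulrA sg sg) sgs.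
    by ring.
  have hp : 0 <= sg * v 0 i / L.
    rewrite divr_ge0 ?(ltW L0)//; have h5 : 0 <= (sg * v 0 i) * L by lra.
    by rewrite -(pmulr_lge0 _ L0).
  have [e1 e2] := proj1 (line _ _) (And3 hS hl hp).
  congr (c + _); rewrite [LHS]vp /elbow_dir -e1 -e2; congr plane.
    by rewrite mulrC divfK.
  by rewrite -mulrA (mulrA sg) (mulrA sg) sgs mul1r mulrC divfK.
have [] := proj2 (line _ _) (conj erefl erefl).
move: ek; rewrite hv /elbow_dir; set C := _ / _; set S := _ / _ => ek h1 h2 h3.
clearbody C S.
have n1 : sqn (plane (L * C) (L * sg * S)) = L ^+ 2.
  by rewrite sqn_plane !exprMn sg1 mulr1 -mulrDr h1 mulr1.
split.
- exact: n1.
- rewrite n1 dot_plane (_ : _ + _ = L * elbow_m L l2 d); first lra.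
  by rewrite -h2; ring.
- rewrite n1 plane_i.
  have : 0 <= L * L * S by rewrite !mulr_ge0// ltW.
  have -> : 2 * (sg * L) * (L * sg * S) = 2 * (sg * sg) * (L * L * S) by ring.
  rewrite sgs; lra.
- by move=> k ko ki; rewrite ek n1 plane_other// mulr0; ring.
Qed.

End Plane.

Section Elbow.
Variables (R : realType) (n j : nat) (B : R) (o i : 'I_n).
Hypothesis oi : o != i.
Local Notation vec := 'rV[R]_n.
Local Notation input := ('I_j * 'I_n -> R).
Local Notation computable := (computable B).
Local Notation vgood := (vgood B).
Local Notation inbox := (inbox B).
Variables (L l2 sg : R) (c : vec) (f : input -> vec).
Hypotheses (L0 : 0 < L) (l20 : 0 < l2) (sg1 : sg ^+ 2 = 1).
Hypothesis hm : forall x, inbox x -> `|elbow_m L l2 (f x - c)| < (f x - c) 0 o.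

Definition elbow (x : input) : vec := c + elbow_dir o i L l2 sg (f x - c).

Lemma elbow_arms x : inbox x -> sqn (elbow x - c) = L ^+ 2 /\ sqn (elbow x - f x) = l2.
Proof. by move=> /hm h; have [] := proj2 (elbow_rigid oi L0 sg1 h (elbow x)) erefl. Qed.

(** Analytic because the discriminant and the denominator [elbow_N] are positive on the box; bounded
    because the upper arm has constant length. *)
Lemma elbow_good : vgood f -> vgood elbow.
Proof.
move=> [af _]; split=> [p pB k|]; last first.
  exists (2 * (L ^+ 2 + sqn c)) => x /elbow_arms[h _].
  by rewrite -(subrK c (elbow x)) -h; exact: sqnD_le.
have ad l : ana p (fun x => (f x - c) 0 l).
  by apply: ana_ext (anaB (af p pB l) (ana_const p (c 0 l))) => x; rewrite !mxE.
have am : ana p (fun x => elbow_m L l2 (f x - c)).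
  apply: anaM (ana_const _ _); apply: anaB (ana_const _ _); apply: anaD (ana_const _ _).
  by apply: ana_sum => l _; exact: anaM.
have asd : ana p (fun x => sg * (f x - c) 0 i) by exact: anaM (ana_const _ _) _.
have aN : ana p (fun x => elbow_N o i sg (f x - c)) by apply: anaD; exact: anaX.
have aw : ana p (fun x => elbow_w o i L l2 sg (f x - c)).
  apply: (ana_sqrt (f := fun x => elbow_N o i sg (f x - c) - elbow_m L l2 (f x - c) ^+ 2)).
    exact: elbow_disc_gt0 (hm pB).
  by apply: anaB => //; exact: anaX.
have aV : ana p (fun x => (elbow_N o i sg (f x - c))^-1).
  by apply: (anaV (f := fun x => elbow_N o i sg (f x - c))) => //; rewrite gt_eqF// (elbow_N_gt0 _ _ (hm pB)).
pose C x := L * ((elbow_m L l2 (f x - c) * (f x - c) 0 o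
  - sg * (f x - c) 0 i * elbow_w o i L l2 sg (f x - c)) / elbow_N o i sg (f x - c)).
pose S x := L * sg * ((elbow_m L l2 (f x - c) * (sg * (f x - c) 0 i)
  + (f x - c) 0 o * elbow_w o i L l2 sg (f x - c)) / elbow_N o i sg (f x - c)).
have aC : ana p C.
  by apply: anaM (ana_const _ _) _; apply: anaM aV; apply: anaB; exact: anaM.
have aS : ana p S.
  by apply: anaM (ana_const _ _) _; apply: anaM aV; apply: anaD; exact: anaM.
have : ana p (fun x => c 0 k + (C x * unitv R o 0 k + S x * unitv R i 0 k)).
  by apply: anaD (ana_const _ _) _; apply: anaD; apply: anaM => //; exact: ana_const.
by apply: ana_ext => x; rewrite /elbow /elbow_dir /plane [RHS]mxE; congr (_ + _); rewrite /C /S !mxE.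
Qed.

Lemma computable_elbow : computable f -> computable elbow.
Proof.
move=> hf.
(* One anchor per axis gives axis [k] the number [3 + k]; the filter [ks] then selects the axes
   orthogonal to the plane. *)
pose args := [:: f; fun=> c; fun=> c + (sg * L) *: unitv R i]
  ++ [seq (fun=> c + L *: unitv R k) | k <- enum 'I_n].
pose r := size args.
have rE : r = (3 + n)%N by rewrite /r /args size_cat size_map size_enum_ord.
pose ks := [seq k <- enum 'I_n | (k != o) && (k != i)].
have LL : 0 < L ^+ 2 by rewrite exprn_gt0.
have LL2 : 0 < 2 * L ^+ 2 by rewrite mulr_gt0.
apply: (@computable_prim _ _ _ B args elbow [::]
  ([:: Rod n r 1 (L ^+ 2); Rod n r 0 l2; Cable n r 2 (2 * L ^+ 2)]%N
   ++ [seq Rod n r (3 + k)%N (2 * L ^+ 2) | k : 'I_n <- ks])).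
- split; first exact: hf.
  split; first exact: computable_const.
  split; first exact: computable_const.
  by apply/every_map/everyP => k _; exact: computable_const.
- by split=> //; exact: elbow_good (computable_good hf).
- rewrite -/r rE; apply/every_cat; split => /=; first by do !split=> //; lia.
  apply/every_map/everyP => k _ /=; have := ltn_ord k; split=> //; lia.
move=> x xB [|w [|]]// _; rewrite /sat every_cat.
have nr : nth 0 (values args x ++ [:: w]) r = w.
  by rewrite nth_cat size_values ltnn subnn.
have nk (k : 'I_n) : nth 0 (values args x ++ [:: w]) (3 + k) = c + L *: unitv R k.
  rewrite nth_cat size_values -/r rE ltn_add2l ltn_ord /args values_cat nth_cat /=.
  rewrite addKn /values -map_comp (nth_map k) ?size_enum_ord//=.
  by rewrite nth_ord_enum.
have rod : every (holds (nth 0 (values args x ++ [:: w])))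
    [seq Rod n r (3 + k)%N (2 * L ^+ 2) | k : 'I_n <- ks] <->
    forall k, k != o -> k != i -> sqn (w - (c + L *: unitv R k)) = 2 * L ^+ 2.
  rewrite every_map everyP; split=> h k.
    move=> ko ki; move: (h k); rewrite /holds nr nk; apply.
    by rewrite mem_filter ko ki mem_enum.
  by rewrite mem_filter => /andP[/andP[ko ki] _]; rewrite /holds nr nk; exact: h.
rewrite rod.
have E := elbow_rigid oi L0 sg1 (hm xB) w.
have -> : every (holds (nth 0 (values args x ++ [:: w])))
  [:: Rod n r 1 (L ^+ 2); Rod n r 0 l2; Cable n r 2 (2 * L ^+ 2)]%N <->
  [/\ sqn (w - c) = L ^+ 2, sqn (w - f x) = l2 &
    sqn (w - (c + (sg * L) *: unitv R i)) <= 2 * L ^+ 2].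
  by rewrite /holds /every nr /=; split=> [[? [? [? _]]]|[? ? ?]].
split=> [[[h1 h2 h3] h4]|[hw]].
  by congr [:: _]; apply/E.
by have [h1 h2 h3 h4] := proj2 E hw.
Qed.

End Elbow.

(** * Sums and multiples of computable functions *)

Section VectorOperations.
Variables (R : realType) (n j : nat) (B : R) (o i : 'I_n).
Hypothesis oi : o != i.
Local Notation vec := 'rV[R]_n.
Local Notation input := ('I_j * 'I_n -> R).
Local Notation computable := (computable B).
Local Notation vbounded := (vbounded B).
Local Notation inbox := (inbox B).
Implicit Types f g : input -> vec.

(** The shoulder is [- D e_o]. The squared forearm [L^2 + D^2] cancels the constant terms of
    [elbow_m], leaving [(|f|^2 + 2 D f_o) / (2 L)]; with [L] large this is below 1, hence below the
    first coordinate of [f] seen from the shoulder. *)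
Lemma far_elbow f D : (forall x, inbox x -> 1 <= f x 0 o + D) -> computable f ->
  exists e s t, [/\ 0 < s, 0 < t, computable e,
    forall x, inbox x -> sqn (e x - - D *: unitv R o) = s &
    forall x, inbox x -> sqn (e x - f x) = t].
Proof.
move=> hD cf; have [_ [M hM]] := computable_good cf.
pose K := `|M| + 1; pose L := K ^+ 2 + 2 * `|D| * K + 1.
have K1 : 1 <= K by rewrite /K lerDr.
have L0 : 0 < L by rewrite ltr_wpDl// addr_ge0// ?mulr_ge0 ?sqr_ge0//; lra.
have l20 : 0 < L ^+ 2 + D ^+ 2 by rewrite ltr_wpDr ?sqr_ge0// exprn_gt0.
have hm x : inbox x ->
    `|elbow_m L (L ^+ 2 + D ^+ 2) (f x - - D *: unitv R o)| < (f x - - D *: unitv R o) 0 o.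
  move=> xB; have := hD x xB => h1.
  have -> : (f x - - D *: unitv R o) 0 o = f x 0 o + D.
    by rewrite !mxE !eqxx mulr1 opprK.
  apply: lt_le_trans h1.
  have -> : elbow_m L (L ^+ 2 + D ^+ 2) (f x - - D *: unitv R o) =
      (sqn (f x) + 2 * D * f x 0 o) / (2 * L).
    rewrite /elbow_m; congr (_ / _).
    rewrite -scalerN -scaleN1r scalerA mulrN1 opprK sqnD sqnZ sqn_unit dotZr dot_unitr.
    ring.
  have fM : sqn (f x) <= K ^+ 2.
    apply: (le_trans (hM x xB)); have := ler_norm M.
    rewrite /K; have := normr_ge0 M; set m := `|M|; nra.
  have fK : `|f x 0 o| <= K.
    rewrite -(ger0_norm (_ : 0 <= K)); last by lra.
    rewrite -ler_sqr ?nnegrE// !real_normK ?num_real//.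
    exact: le_trans (coord_sqr_le _ _) fM.
  rewrite normrM normfV ltr_pdivrMr; last by rewrite normr_gt0 gt_eqF// mulr_gt0.
  rewrite mul1r (gtr0_norm (_ : 0 < 2 * L)) ?mulr_gt0//.
  apply: (le_lt_trans (ler_normD _ _)).
  rewrite (ger0_norm (sqn_ge0 _)) !normrM (gtr0_norm (_ : 0 < 2)) //.
  have : `|D| * `|f x 0 o| <= `|D| * K by rewrite ler_wpM2l.
  have : 0 <= `|D| * K by rewrite mulr_ge0//; lra.
  have := sqn_ge0 (f x); rewrite -!mulrA /L; lra.
exists (elbow o i L (L ^+ 2 + D ^+ 2) 1 (- D *: unitv R o) f), (L ^+ 2), (L ^+ 2 + D ^+ 2).
have s1 : (1 : R) ^+ 2 = 1 by rewrite expr1n.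
split=> //; first exact: exprn_gt0.
- exact: computable_elbow.
- by move=> x xB; have [] := elbow_arms oi L0 s1 hm xB.
- by move=> x xB; have [] := elbow_arms oi L0 s1 hm xB.
Qed.

(** The homothety of ratio [l] centred at the shoulder [c = - D e_o]. With elbow [e], both segments
    of the chain are scaled, to [c + l (e - c)] and [e + l (f - e)]; the parallelogram on these two
    points and [e] ends at [c + l (f - c)]. *)
Lemma computable_scale_at f D l : (forall x, inbox x -> 1 <= f x 0 o + D) ->
  computable f -> computable (fun x => l *: f x + (l - 1) * D *: unitv R o).
Proof.
move=> hD cf; have [e [s [t [s0 t0 ce he hf]]]] := far_elbow hD cf.
pose c : vec := - D *: unitv R o.
have [->|l0] := eqVneq l 0.
  by apply: computable_eq (computable_const j B c) => x; rewrite scale0r add0r sub0r mulN1r.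
have [->|l1] := eqVneq l 1.
  by apply: computable_eq cf => x; rewrite scale1r subrr mul0r scale0r addr0.
have c1 := computable_extend l (computable_const j B c) ce s0 he.
have hf' x : inbox x -> sqn (f x - e x) = t by move=> /hf; rewrite sqnB_sym.
have c2 := computable_extend l ce cf t0 hf'.
have s1 : 0 < (l - 1) ^+ 2 * s by rewrite mulr_gt0// exprn_even_gt0//= subr_eq0.
have t1 : 0 < l ^+ 2 * t by rewrite mulr_gt0// exprn_even_gt0.
apply: computable_eq (computable_par ce c1 c2 s1 t1 _ _) => [x|x xB|x xB].
- by rewrite /c; apply/rowP => k; rewrite !mxE; ring.
- rewrite -(he x xB) -sqnZ; congr sqn; apply/rowP => k; rewrite !mxE; ring.
- by rewrite -(hf' x xB) -sqnZ; congr sqn; apply/rowP => k; rewrite !mxE; ring.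
Qed.

(** With shoulder [c = - D e_o] and elbows [e], [e'], four parallelograms with constant sides
    produce in turn [e + e' - c], [f + e' - c], [g + e - c] and [f + g - c]. *)
Lemma computable_add_at f g D :
  (forall x, inbox x -> 1 <= f x 0 o + D) -> (forall x, inbox x -> 1 <= g x 0 o + D) ->
  computable f -> computable g -> computable (fun x => f x + g x + D *: unitv R o).
Proof.
move=> hf hg cf cg.
have [e [s [t [s0 t0 ce es ft]]]] := far_elbow hf cf.
have [e' [s' [t' [s0' t0' ce' es' gt]]]] := far_elbow hg cg.
have cc := computable_const j B (- D *: unitv R o).
have ch1 := computable_par cc ce ce' s0 s0' es es'.
have ft1 x : inbox x -> sqn (f x - e x) = t by move=> /ft; rewrite sqnB_sym.
have gt1 x : inbox x -> sqn (g x - e' x) = t' by move=> /gt; rewrite sqnB_sym.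
have k2 x : inbox x -> sqn (e x + e' x - - D *: unitv R o - e x) = s'.
  by move=> xB; rewrite -(es' x xB); congr sqn; apply/rowP => k; rewrite !mxE; ring.
have ch2 := computable_par ce cf ch1 t0 s0' ft1 k2.
have k3 x : inbox x -> sqn (e x + e' x - - D *: unitv R o - e' x) = s.
  by move=> xB; rewrite -(es x xB); congr sqn; apply/rowP => k; rewrite !mxE; ring.
have ch3 := computable_par ce' cg ch1 t0' s0 gt1 k3.
have k4 x : inbox x -> sqn (f x + (e x + e' x - - D *: unitv R o) - e x
    - (e x + e' x - - D *: unitv R o)) = t.
  by move=> xB; rewrite -(ft1 x xB); congr sqn; apply/rowP => k; rewrite !mxE; ring.
have k5 x : inbox x -> sqn (g x + (e x + e' x - - D *: unitv R o) - e' x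
    - (e x + e' x - - D *: unitv R o)) = t'.
  by move=> xB; rewrite -(gt1 x xB); congr sqn; apply/rowP => k; rewrite !mxE; ring.
have ch4 := computable_par ch1 ch2 ch3 t0 t0' k4 k5.
by apply: computable_eq ch4 => x; apply/rowP => k; rewrite !mxE; ring.
Qed.

Lemma vbounded_far f : vbounded f ->
  exists D0, forall D, D0 <= D -> forall x, inbox x -> 1 <= f x 0 o + D.
Proof.
move=> [M hM]; exists (`|M| + 2) => D MD x /hM h.
have := le_trans (coord_sqr_le (f x) o) h; have := ler_norm M; have := normr_ge0 M.
set a := f x 0 o; set m := `|M| in MD *; rewrite expr2 => *.
have : - (m + 1) <= a by nra.
lra.
Qed.

(* Two homotheties of ratios 1/2 and 2 with different centres. *)
Lemma computable_translate f t : computable f ->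
  computable (fun x => f x + t *: unitv R o).
Proof.
move=> cf; have [_ bf] := computable_good cf.
have [D0 hD0] := vbounded_far bf.
pose D := `|D0| + 2 * `|t| + 1; have t0 := normr_ge0 t.
have D0D : D0 <= D by rewrite /D; have := ler_norm D0; lra.
have h1 := computable_scale_at 2^-1 (hD0 _ D0D) cf.
have h2 x : inbox x -> 1 <= (2^-1 *: f x + (2^-1 - 1) * D *: unitv R o) 0 o + (D + t).
  move=> xB; have := hD0 _ (ler_norm D0) x xB; rewrite !mxE !eqxx mulr1.
  by have := ler_norm (- t); rewrite normrN /D; lra.
apply: computable_eq (computable_scale_at 2 h2 h1) => x.
by apply/rowP => k; rewrite !mxE; field.
Qed.

Lemma computableD f g : computable f -> computable g ->
  computable (fun x => f x + g x).
Proof.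
move=> cf cg; have [_ /vbounded_far[D1 h1]] := computable_good cf.
have [_ /vbounded_far[D2 h2]] := computable_good cg.
have m1 : D1 <= Num.max D1 D2 by rewrite le_max lexx.
have m2 : D2 <= Num.max D1 D2 by rewrite le_max lexx orbT.
have := computable_translate (- Num.max D1 D2) (computable_add_at (h1 _ m1) (h2 _ m2) cf cg).
by apply: computable_eq => x; rewrite scaleNr addrK.
Qed.

Lemma computableZ l f : computable f -> computable (fun x => l *: f x).
Proof.
move=> cf; have [_ /vbounded_far[D h]] := computable_good cf.
have := computable_translate (- ((l - 1) * D)) (computable_scale_at l (h _ (lexx D)) cf).
by apply: computable_eq => x; rewrite scaleNr addrK.
Qed.

End VectorOperations.

(** * Inversion, coordinate projections, products and polynomials *)

Section Algebra.
Variables (R : realType) (n j : nat) (B : R).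
Local Notation vec := 'rV[R]_n.
Local Notation input := ('I_j * 'I_n -> R).
Local Notation computable := (computable B).
Local Notation vgood := (vgood B).
Local Notation inbox := (inbox B).
Implicit Types f g : input -> vec.

Lemma inbox_ball (p : input) : inbox p ->
  exists2 r, 0 < r & forall x, (forall q, `|x q - p q| < r) -> inbox x.
Proof.
move=> pB.
have [s [s0 hs]] : exists s, 0 < s /\ forall q, q \in enum {: 'I_j * 'I_n} -> s <= B - `|p q|.
  elim: (enum _) => [|q qs [s [s0 hs]]]; first by exists 1.
  exists (Num.min s (B - `|p q|)); split; first by rewrite lt_min s0 subr_gt0 pB.
  move=> q'; rewrite inE => /orP[/eqP ->|/hs h]; first by rewrite ge_min lexx orbT.
  by rewrite ge_min h.
exists s => // x xp q; have := hs q; rewrite mem_enum => /(_ isT).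
have := ler_normD (x q - p q) (p q); rewrite subrK; have := xp q; lra.
Qed.

(** Analyticity is required at points of the box only, and the box is open, so values outside it do
    not matter. *)
Lemma computable_eq_in f g : (forall x, inbox x -> f x = g x) ->
  computable f -> computable g.
Proof.
move=> fg [[af [M hM]] h]; split; last first.
  move=> fs /h[gs [h1 [k k1 k2]]]; exists gs; split=> //; exists k => // x xB.
  by rewrite k2// fg.
split; last by exists M => x xB; rewrite -fg//; exact: hM.
move=> p pB k; have [r [K [r0 hr]]] := af p pB k.
have [s s0 hs] := inbox_ball pB.
have m0 : 0 < Num.min r s by rewrite lt_min r0.
exists (Num.min r s), K; split=> //.
apply: psn_eq (psn_shrink (ltW m0) _ hr) => [x xp|]; last by rewrite ge_min lexx.
rewrite fg//; apply: hs => q; apply: (lt_le_trans (xp q)).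
by rewrite ge_min lexx orbT.
Qed.

Section TwoAxes.
Variables (o i : 'I_n).
Hypothesis oi : o != i.

Definition pcomp (u v : input -> R) := computable (fun x => plane o i (u x) (v x)).

Lemma pcomp_eq_in u v u' v' : (forall x, inbox x -> u x = u' x) ->
  (forall x, inbox x -> v x = v' x) -> pcomp u v -> pcomp u' v'.
Proof. by move=> uu vv; apply: computable_eq_in => x xB; rewrite uu// vv. Qed.

Lemma pcompD u v u' v' : pcomp u v -> pcomp u' v' ->
  pcomp (fun x => u x + u' x) (fun x => v x + v' x).
Proof. by move=> h /(computableD oi h); apply: computable_eq => x; rewrite planeD. Qed.

Lemma pcompZ k u v : pcomp u v -> pcomp (fun x => k * u x) (fun x => k * v x).
Proof. by move=> /(computableZ oi k); apply: computable_eq => x; rewrite planeZ. Qed.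

Lemma pcomp_const a b : pcomp (fun=> a) (fun=> b).
Proof. exact: computable_const. Qed.

(** The positions for [sg = 1] and [sg = -1] differ only in the sign of the square-root terms, which
    cancel in the sum. *)
Lemma computable_elbow_sum f l2 : 0 < l2 -> computable f ->
  (forall x, inbox x -> `|(sqn (f x) + 1 - l2) / 2| < f x 0 o) ->
  pcomp (fun x => (sqn (f x) + 1 - l2) * f x 0 o / (f x 0 o ^+ 2 + f x 0 i ^+ 2))
        (fun x => (sqn (f x) + 1 - l2) * f x 0 i / (f x 0 o ^+ 2 + f x 0 i ^+ 2)).
Proof.
move=> l20 cf hf.
have me (d : vec) : elbow_m 1 l2 (d - 0) = (sqn d + 1 - l2) / 2.
  by rewrite /elbow_m subr0 expr1n mulr1.
have hm x : inbox x -> `|elbow_m 1 l2 (f x - 0)| < (f x - 0) 0 o.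
  by move=> xB; rewrite me subr0; exact: hf.
have s1 : (1 : R) ^+ 2 = 1 by rewrite expr1n.
have s2 : (- 1 : R) ^+ 2 = 1 by rewrite sqrrN expr1n.
have e1 := computable_elbow oi ltr01 l20 s1 hm cf.
have e2 := computable_elbow oi ltr01 l20 s2 hm cf.
apply: computable_eq_in (computableD oi e1 e2) => x xB.
have N0 : f x 0 o ^+ 2 + f x 0 i ^+ 2 != 0.
  rewrite gt_eqF// ltr_wpDr ?sqr_ge0// exprn_gt0//.
  exact: le_lt_trans (normr_ge0 _) (hf x xB).
rewrite /elbow !add0r /elbow_dir planeD /elbow_w /elbow_N me subr0.
rewrite mul1r mulN1r sqrrN !mul1r.
by congr plane; field.
Qed.

(* The two intersection points of a line with a circle centred at the origin
   add up to twice the foot of the perpendicular; a difference of two such sums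
   is the inversion. *)
Lemma computable_inversion f : computable f ->
  (forall x, inbox x -> 3 / 4 <= f x 0 o) ->
  (forall x, inbox x -> 1 / 4 <= sqn (f x) <= 7 / 4) ->
  pcomp (fun x => f x 0 o / (f x 0 o ^+ 2 + f x 0 i ^+ 2))
        (fun x => f x 0 i / (f x 0 o ^+ 2 + f x 0 i ^+ 2)).
Proof.
move=> cf h1 h2.
(* The squared forearms 3/2 and 5/2 differ by 1, so the difference of the two sums is exactly the
   inversion; both give [|elbow_m| <= 5/8], below the assumed 3/4. *)
have E (l2 : R) : 3 / 2 <= l2 -> l2 <= 5 / 2 -> forall x, inbox x ->
    `|(sqn (f x) + 1 - l2) / 2| < f x 0 o.
  move=> l1 l2' x xB; have := h1 x xB; have /andP[a b] := h2 x xB.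
  by rewrite ltr_norml => c; apply/andP; split; lra.
have k1 : 0 < 3 / 2 :> R by lra.
have k2 : 0 < 5 / 2 :> R by lra.
have k3 : 3 / 2 <= 5 / 2 :> R by lra.
have c1 := computable_elbow_sum k1 cf (E _ (lexx _) k3).
have c2 := computable_elbow_sum k2 cf (E _ k3 (lexx _)).
have := pcompD c1 (pcompZ (-1) c2).
by apply: pcomp_eq_in => x xB; set q := (f x 0 o ^+ 2 + _)^-1; lra.
Qed.

Lemma pcomp_inversion u v : pcomp u v ->
  (forall x, inbox x -> 3 / 4 <= u x) ->
  (forall x, inbox x -> 1 / 4 <= u x ^+ 2 + v x ^+ 2 <= 7 / 4) ->
  pcomp (fun x => u x / (u x ^+ 2 + v x ^+ 2)) (fun x => v x / (u x ^+ 2 + v x ^+ 2)).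
Proof.
move=> c h1 h2.
have := computable_inversion c _ _.
have h x : inbox x -> 3 / 4 <= plane o i (u x) (v x) 0 o by rewrite plane_o//; exact: h1.
have h' x : inbox x -> 1 / 4 <= sqn (plane o i (u x) (v x)) <= 7 / 4.
  by rewrite sqn_plane//; exact: h2.
by move=> /(_ h h'); apply: pcomp_eq_in => x _; rewrite plane_o// plane_i.
Qed.

(* In complex notation the inversion is [J z = 1 / conj z], and for [z = 1 + X + i Y]
   one has [J (2 J z - 1) + 1 = 2 J (1 - X + i Y)]: so the reflection
   [1 - X + i Y] of [z] is computable, and averaging separates [X] from [Y]. *)
Lemma pcomp_near1 f d : computable f ->
  (forall x, inbox x -> `|d * f x 0 o| <= 100^-1) ->
  (forall x, inbox x -> d ^+ 2 * sqn (f x) <= 100^-1) ->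
  pcomp (fun x => d * f x 0 o) (fun=> 0) /\ pcomp (fun=> 0) (fun x => d * f x 0 i).
Proof.
move=> cf hX hY.
pose X x := d * f x 0 o; pose Y x := d * f x 0 i.
pose N x := (1 + X x) ^+ 2 + Y x ^+ 2; pose N' x := (1 - X x) ^+ 2 + Y x ^+ 2.
have bX x : inbox x -> - 100^-1 <= X x <= 100^-1 by move=> /hX; rewrite ler_norml.
have bY x : inbox x -> X x ^+ 2 + Y x ^+ 2 <= 100^-1.
  move=> xB; apply: le_trans (hY x xB); rewrite /X /Y !exprMn -mulrDr ler_wpM2l ?sqr_ge0//.
  rewrite /sqn /dot (bigD1 o)//= (bigD1 i)/=; last by rewrite eq_sym.
  by rewrite !expr2 addrA lerDl; apply: sumr_ge0 => k _; rewrite -expr2 sqr_ge0.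
have bN x : inbox x -> 97/100 <= N x <= 104/100.
  move=> xB; have /andP[a b] := bX x xB; have := bY x xB.
  rewrite /N; move: (X x) (Y x) a b => a b h1 h2; have := sqr_ge0 a; have := sqr_ge0 b.
  by move=> *; apply/andP; split; nra.
have bN' x : inbox x -> 97/100 <= N' x <= 104/100.
  move=> xB; have /andP[a b] := bX x xB; have := bY x xB.
  rewrite /N'; move: (X x) (Y x) a b => a b h1 h2; have := sqr_ge0 a; have := sqr_ge0 b.
  by move=> *; apply/andP; split; nra.
have N0 x : inbox x -> 0 < N x by move=> /bN/andP[a b]; lra.
have N0' x : inbox x -> 0 < N' x by move=> /bN'/andP[a b]; lra.
have cu := computableD oi (computable_const j B (unitv R o)) (computableZ oi d cf).
have uo x : (unitv R o + d *: f x) 0 o = 1 + X x by rewrite !mxE !eqxx.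
have ui x : (unitv R o + d *: f x) 0 i = Y x.
  by rewrite !mxE !eqxx eq_sym (negbTE oi) add0r.
have c1 : pcomp (fun x => (1 + X x) / N x) (fun x => Y x / N x).
  apply: pcomp_eq_in (computable_inversion cu _ _) => x xB; rewrite ?uo ?ui//.
    by have /andP[a b] := bX x xB; lra.
  rewrite sqnD sqnZ sqn_unit dotZr dotC dot_unitr -/(X x).
  have /andP[a b] := bX x xB; have := hY x xB.
  have := mulr_ge0 (sqr_ge0 d) (sqn_ge0 (f x)) => *; apply/andP; split; lra.
have inv_range (a b : R) : 97/100 <= a <= 104/100 -> 97/100 <= b <= 104/100 ->
    1 / 4 <= a / b <= 7 / 4.
  move=> /andP[a1 a2] /andP[b1 b2]; have b0 : 0 < b by lra.
  by rewrite ler_pdivlMr// ler_pdivrMr//; apply/andP; split; lra.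
have n1 x : inbox x -> ((1 + X x) / N x) ^+ 2 + (Y x / N x) ^+ 2 = 1 / N x.
  by move=> /N0; rewrite /N => /lt0r_neq0 ?; field.
(* The second inversion returns [z], now without the components along the other axes. *)
have c2 : pcomp (fun x => 1 + X x) Y.
  apply: pcomp_eq_in (pcomp_inversion c1 _ _) => x xB; rewrite ?n1//.
  - by have := N0 x xB => /lt0r_neq0 ?; field.
  - by have := N0 x xB => /lt0r_neq0 ?; field.
  - rewrite ler_pdivlMr ?N0//; have /andP[? ?] := bN x xB.
    by have /andP[? ?] := bX x xB; lra.
  - by apply: inv_range (bN x xB); lra.
(* This is [2 J z - 1], of squared norm [N' / N], which is close enough to 1 for another
   inversion. *)
have c3 := pcompD (pcompZ 2 c1) (pcomp_const (-1) 0).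
have n3 x : inbox x -> (2 * ((1 + X x) / N x) + -1) ^+ 2 + (2 * (Y x / N x) + 0) ^+ 2 = N' x / N x.
  by move=> /N0; rewrite /N /N' => /lt0r_neq0 ?; field.
have c5 : pcomp (fun x => (1 - X x) / N' x) (fun x => Y x / N' x).
  have c4 := pcomp_inversion c3.
  have {}c4 := pcompZ 2^-1 (pcompD (c4 _ _) (pcomp_const 1 0)).
  apply: pcomp_eq_in (c4 _ _) => x xB; rewrite ?n3//.
  - have := N0 x xB; have := N0' x xB; rewrite /N /N' => /lt0r_neq0 ? /lt0r_neq0 ?.
    by field; apply/andP.
  - have := N0 x xB; have := N0' x xB; rewrite /N /N' => /lt0r_neq0 ? /lt0r_neq0 ?.
    by field; apply/andP.
  - suff : 7 / 8 <= (1 + X x) / N x by lra.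
    rewrite ler_pdivlMr ?N0//; have /andP[? ?] := bN x xB.
    by have /andP[? ?] := bX x xB; lra.
  - exact: inv_range (bN' x xB) (bN x xB).
have n5 x : inbox x -> ((1 - X x) / N' x) ^+ 2 + (Y x / N' x) ^+ 2 = 1 / N' x.
  by move=> /N0'; rewrite /N' => /lt0r_neq0 ?; field.
have c6 : pcomp (fun x => 1 - X x) Y.
  apply: pcomp_eq_in (pcomp_inversion c5 _ _) => x xB; rewrite ?n5//.
  - by have := N0' x xB => /lt0r_neq0 ?; field.
  - by have := N0' x xB => /lt0r_neq0 ?; field.
  - rewrite ler_pdivlMr ?N0'//; have /andP[? ?] := bN' x xB.
    by have /andP[? ?] := bX x xB; lra.
  - by apply: inv_range (bN' x xB); lra.
split.
  by apply: pcomp_eq_in (pcompD (pcompZ 2^-1 c2) (pcompZ (- 2^-1) c6)) => x _; rewrite ?/X; field.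
have := pcompD (pcompD (pcompZ 2^-1 c2) (pcompZ 2^-1 c6)) (pcomp_const (-1) 0).
by apply: pcomp_eq_in => x _; rewrite ?/Y; field.
Qed.

(** With [|f| <= K], the factor [d = 1 / (100 K)] brings [f] into the range of [pcomp_near1]; the
    result is scaled back. *)
Lemma computable_projections f : computable f ->
  pcomp (fun x => f x 0 o) (fun=> 0) /\ pcomp (fun=> 0) (fun x => f x 0 i).
Proof.
move=> cf; have [_ [M hM]] := computable_good cf.
pose K := `|M| + 1; have K1 : 1 <= K by rewrite lerDr.
pose d := (100 * K)^-1.
have K100 : 0 < 100 * K by lra.
have d0 : 0 < d by rewrite invr_gt0.
have hK x : inbox x -> sqn (f x) <= K ^+ 2.
  move=> /hM h; apply: (le_trans h); have := ler_norm M; rewrite /K.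
  by have := normr_ge0 M; set m := `|M|; nra.
have [||c1 c2] := @pcomp_near1 f d cf.
- move=> x xB; rewrite normrM gtr0_norm// mulrC /d invfM mulrCA ger_pMr ?invr_gt0//.
  rewrite ler_pdivrMr ?mul1r; last by lra.
  rewrite -(ger0_norm (_ : 0 <= K)); last by lra.
  rewrite -ler_sqr ?nnegrE// !real_normK ?num_real//.
  exact: le_trans (coord_sqr_le _ _) (hK x xB).
- move=> x xB; have := hK x xB; rewrite /d exprVn mulrC ler_pdivrMr ?exprn_gt0//.
  by rewrite exprMn; have := sqr_ge0 K; lra.
have dn : d != 0 by rewrite gt_eqF.
split; [have := pcompZ d^-1 c1|have := pcompZ d^-1 c2];
  apply: pcomp_eq_in => x _; by rewrite ?mulr0// mulKf.
Qed.

(** The inversion of [1 + i e s] has real part [1 / (1 + e^2 s^2)]; projecting to the real axis and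
    inverting there gives [1 + e^2 s^2]. The factor [e] keeps [(e s)^2 <= 1/4], so that both
    inversions stay in range. *)
Lemma pcomp_square s : pcomp (fun=> 0) s -> pcomp (fun x => s x ^+ 2) (fun=> 0).
Proof.
move=> cs; have [_ [M hM]] := computable_good cs.
have hM' x : inbox x -> s x ^+ 2 <= M.
  by move=> /hM; rewrite sqn_plane// expr0n add0r.
pose e := (4 * (`|M| + 1))^-1.
have M1 : 0 < 4 * (`|M| + 1) by rewrite mulr_gt0// ltr_wpDl.
have e0 : 0 < e by rewrite invr_gt0.
have es x : inbox x -> (e * s x) ^+ 2 <= 4^-1.
  move=> xB; rewrite exprMn /e exprVn mulrC ler_pdivrMr ?exprn_gt0//.
  have := hM' x xB; have := ler_norm M; have := normr_ge0 M.
  by set m := `|M| => *; rewrite exprMn; nra.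
have p x : 0 < 1 + (e * s x) ^+ 2 by rewrite ltr_wpDr ?sqr_ge0.
have pn x : 1 + (e * s x) ^+ 2 != 0 by rewrite gt_eqF.
have c1 := pcompD (pcomp_const 1 0) (pcompZ e cs).
have [c2 _] : pcomp (fun x => 1 / (1 + (e * s x) ^+ 2)) (fun=> 0) /\ True.
  split=> //; have c := pcomp_inversion c1.
  have [|x xB|c3 _] := computable_projections (c _ _).
  - by move=> x _; lra.
  - have := es x xB; have := sqr_ge0 (e * s x); rewrite !mulr0 !addr0 add0r expr1n.
    by move=> *; apply/andP; split; lra.
  apply: pcomp_eq_in c3 => x _ //; rewrite plane_o//.
  by rewrite !mulr0 !addr0 add0r expr1n.
have c3 : pcomp (fun x => 1 + (e * s x) ^+ 2) (fun=> 0).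
  apply: pcomp_eq_in (pcomp_inversion c2 _ _) => x xB.
  - by field.
  - by rewrite mul0r.
  - by rewrite ler_pdivlMr//; have := es x xB; lra.
  - rewrite expr0n addr0 expr_div_n expr1n ler_pdivlMr ?exprn_gt0//.
    rewrite ler_pdivrMr ?exprn_gt0//.
    have := es x xB; have := sqr_ge0 (e * s x); move: (_ ^+ 2) => q *.
    by apply/andP; split; nra.
have e2 : e ^+ 2 != 0 by rewrite expf_neq0// gt_eqF.
have := pcompZ (e ^- 2) (pcompD c3 (pcomp_const (-1) 0)).
apply: pcomp_eq_in => x _; last by rewrite addr0 mulr0.
by field; rewrite gt_eqF.
Qed.

(** Squaring moves a scalar from the second axis to the first, so [s = ((s + 1)^2 - s^2 - 1) / 2]
    transfers [s] itself. *)
Lemma pcomp_swap s : pcomp (fun=> 0) s -> pcomp s (fun=> 0).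
Proof.
move=> cs; have c1 := pcomp_square cs.
have cs1 : pcomp (fun=> 0) (fun x => s x + 1).
  by apply: pcomp_eq_in (pcompD cs (pcomp_const 0 1)) => x _; rewrite ?addr0.
have := pcompZ 2^-1 (pcompD (pcompD (pcomp_square cs1) (pcompZ (-1) c1)) (pcomp_const (-1) 0)).
by apply: pcomp_eq_in => x _; field.
Qed.

End TwoAxes.

Lemma pcomp_flip o i u v : pcomp o i u v -> pcomp i o v u.
Proof. by apply: computable_eq => x; rewrite /plane addrC. Qed.

Section Scalars.
Variables (o i : 'I_n).
Hypothesis oi : o != i.

Definition scal (s : input -> R) := computable (fun x => s x *: unitv R o).

Lemma scal_pcomp (k : 'I_n) s : pcomp o k s (fun=> 0) <-> scal s.
Proof. by split; apply: computable_eq => x; rewrite /plane scale0r addr0. Qed.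

Lemma scal_eq s t : s =1 t -> scal s -> scal t.
Proof. by move=> /funext ->. Qed.

Lemma scal_const a : scal (fun=> a).
Proof. exact: computable_const. Qed.

Lemma scalD s t : scal s -> scal t -> scal (fun x => s x + t x).
Proof. by move=> hs /(computableD oi hs); apply: computable_eq => x; rewrite scalerDl. Qed.

Lemma scalZ k s : scal s -> scal (fun x => k * s x).
Proof. by move=> /(computableZ oi k); apply: computable_eq => x; rewrite scalerA. Qed.

(** [pcomp_square] takes its argument on the second axis, so [s] is first carried from axis [o] to
    axis [i] by a swap with exchanged roles. *)
Lemma scal_square s : scal s -> scal (fun x => s x ^+ 2).
Proof.
have io : i != o by rewrite eq_sym.
move=> /(scal_pcomp i) /pcomp_flip /(pcomp_swap io) /pcomp_flip.
by move=> /(pcomp_square oi) /scal_pcomp.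
Qed.

Lemma scalM s t : scal s -> scal t -> scal (fun x => s x * t x).
Proof.
move=> hs ht; have h1 := scal_square (scalD hs ht).
have h2 := scal_square (scalD hs (scalZ (-1) ht)).
by apply: scal_eq (scalZ 4^-1 (scalD h1 (scalZ (-1) h2))) => x; field.
Qed.

Lemma scalX s k : scal s -> scal (fun x => s x ^+ k).
Proof.
move=> hs; elim: k => [|k IH]; first exact: scal_const.
by apply: scal_eq (scalM hs IH) => x; rewrite exprS.
Qed.

Lemma scal_coord q : scal (fun x => x q).
Proof.
case: q => a k; have ca := (@computable_input R n j B a).
have [->|ko] := eqVneq k o.
  have [/scal_pcomp h _] := computable_projections oi ca.
  by apply: scal_eq h => x; rewrite mxE.
have ok : o != k by rewrite eq_sym.
have [_ /(pcomp_swap ok)/scal_pcomp] := computable_projections ok ca.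
by apply: scal_eq => x; rewrite mxE.
Qed.

Lemma scal_sum (T : Type) (r : seq T) (F : T -> input -> R) :
  (forall t, scal (F t)) -> scal (fun x => \sum_(t <- r) F t x).
Proof.
move=> h; elim: r => [|t r IH].
  by apply: scal_eq (scal_const 0) => x; rewrite big_nil.
by apply: scal_eq (scalD (h t) IH) => x; rewrite big_cons.
Qed.

Lemma scal_prod (T : Type) (r : seq T) (F : T -> input -> R) :
  (forall t, scal (F t)) -> scal (fun x => \prod_(t <- r) F t x).
Proof.
move=> h; elim: r => [|t r IH].
  by apply: scal_eq (scal_const 1) => x; rewrite big_nil.
by apply: scal_eq (scalM (h t) IH) => x; rewrite big_cons.
Qed.

Lemma scal_poly (p : mpoly.mpoly #|{: 'I_j * 'I_n}| R) : scal (peval p).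
Proof.
apply: (@scal_eq (fun x => \sum_(m <- mpoly.msupp p) mpoly.mcoeff m p *
   \prod_(k < #|{: 'I_j * 'I_n}|) x (enum_val k) ^+ m k)).
  by move=> x; rewrite /peval mpoly.mevalE.
apply: scal_sum => m; apply: scalZ; apply: scal_prod => k.
by apply: scalX; exact: scal_coord.
Qed.

End Scalars.

End Algebra.

(** * Compact sets and open boxes in coordinate spaces *)

Section PointwiseTopology.
Variables (R : realType) (I : finType).

Lemma coord_continuous (i : I) : continuous (fun x : {ptws I -> R} => x i : R).
Proof. exact: (@proj_continuous I (fun=> R) i). Qed.

Lemma box_compact (b : R) : compact_set [set x : I -> R | forall i, `|x i| <= b].
Proof.
have := @tychonoff I (fun=> R) (fun i => `[- b, b]%classic) (fun i => @segment_compact R _ _).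
rewrite /compact_set; congr (compact _); apply/seteqP; split => x /= h i;
  by have := h i; rewrite /= in_itv /= ler_norml.
Qed.

Lemma compact_set_bounded (X : set (I -> R)) : compact_set X ->
  exists2 M, 0 <= M & forall x, X x -> forall i, `|x i| <= M.
Proof.
move=> cX.
have h i : exists M, forall x, X x -> `|x i| <= M.
  have : compact ((fun x : {ptws I -> R} => x i : R) @` X).
    apply: (@continuous_compact {ptws I -> R} R) => //.
    by apply: continuous_subspaceT; exact: coord_continuous.
  move=> /compact_bounded [M [_ hM]]; exists (M + 1) => x Xx.
  by apply: (hM (M + 1)); [rewrite ltrDl|exists x].
have [M [M0 hM]] : exists M, 0 <= M /\ forall i, i \in enum I -> forall x, X x -> `|x i| <= M.
  elim: (enum I) => [|i s [M [M0 hM]]]; first by exists 0.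
  have [K hK] := h i; exists (Num.max M K); split; first by rewrite le_max M0.
  move=> i'; rewrite inE => /orP[/eqP ->|/hM{}hM] x Xx; rewrite le_max.
    by rewrite hK// orbT.
  by rewrite hM.
by exists M => // x Xx i; apply: hM; rewrite ?mem_enum.
Qed.

Lemma open_box (P : pred I) (b : R) :
  open_set [set x : I -> R | forall i, P i -> `|x i| < b].
Proof.
rewrite /open_set.
suff h (s : seq I) : open [set x : {ptws I -> R} | forall i, i \in s -> P i -> `|x i| < b].
  have := h (enum I); congr (open _); apply/seteqP; split => x /= h' i; last by move=> _; exact: h'.
  by apply: h'; rewrite mem_enum.
elim: s => [|i s IH].
  have := @openT {ptws I -> R}; congr (open _); apply/seteqP; split => x //=.
case: (boolP (P i)) => Pi.
  have oi : open ((fun x : {ptws I -> R} => x i : R) @^-1` [set y : R | `|y| < b]).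
    apply: open_comp => [x _|]; first exact: coord_continuous.
    have := @open_comp R R (fun y => `|y|) [set y : R | y < b].
    by apply=> [y _|]; [exact: norm_continuous|exact: open_lt].
  have := openI oi IH; congr (open _); apply/seteqP; split => x /=.
    by move=> [h1 h2] i'; rewrite inE => /orP[/eqP ->|/h2].
  move=> h; split; first by apply: h => //; rewrite mem_head.
  by move=> i' i's; apply: h; rewrite inE i's orbT.
move: IH; congr (open _); apply/seteqP; split => x /= h i'.
  by rewrite inE => /orP[/eqP ->|/h//]; rewrite (negbTE Pi).
by move=> i's; apply: h; rewrite inE i's orbT.
Qed.

End PointwiseTopology.

(** * From constraint systems to linkages *)

Section LinkageOfConstraints.
Variables (R : realType) (n : nat) (V : finType).
Local Notation vec := 'rV[R]_n.
Implicit Types (cs : seq (constr R n V)) (c : constr R n V) (phi : V -> vec).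

Definition rowf (phi : V * 'I_n -> R) (v : V) : vec := \row_i phi (v, i).

Lemma vdistE (phi : V * 'I_n -> R) v w : vdist phi v w = Num.sqrt (sqn (rowf phi v - rowf phi w)).
Proof.
by congr Num.sqrt; apply: eq_bigr => i _; rewrite !mxE expr2.
Qed.

Definition cpos (T : Type) (c : constr R n T) : Prop :=
  match c with Fix _ _ => True | Rod _ _ s | Cable _ _ s => 0 < s end.

Definition is_fix v c := if c is Fix v' _ then v == v' else false.
Definition rod_on e c := if c is Rod v w _ then (v != w) && (e == [set v; w]%SET) else false.
Definition touches e c :=
  match c with
  | Fix _ _ => false
  | Rod v w _ | Cable v w _ => (v != w) && (e == [set v; w]%SET)
  end.
Definition edge_ok e (d : R) c : Prop :=
  match c with
  | Fix _ _ => True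
  | Rod v w s => (v != w) && (e == [set v; w]%SET) -> d = s
  | Cable v w s => (v != w) && (e == [set v; w]%SET) -> d <= s
  end.

(* Constraints that concern the same edge are merged into one; the rods among
   them agree because the system has a solution. *)
Lemma merge_edge e cs d0 : every (@cpos V) cs -> every (edge_ok e d0) cs ->
  exists q, 0 < q /\ forall d, every (edge_ok e d) cs <->
    if has (rod_on e) cs then d = q else if has (touches e) cs then is_true (d <= q) else True.
Proof.
elim: cs => [_ _|c cs IH] /=; first by exists 1.
move=> [c0 /IH{}IH] [okc ok]; have [q [q0 hq]] := IH ok.
have hd0 := proj1 (hq d0) ok.
case: c c0 okc => [v u|v w s|v w s] /= c0; first by exists q; split=> // d; rewrite hq; tauto.
- case: ((v != w) && _) => [/(_ isT) ds|_]; last by exists q; split=> // d; rewrite hq /=; split=> [[]|].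
  exists s; split=> //= d; rewrite hq -ds; move: hd0; case: (has (rod_on e) cs).
    by move=> ->; split=> [[]|->].
  by case: (has (touches e) cs) => [h|_]; [split=> [[/(_ isT)]|-> //]|split=> [[/(_ isT)]|-> //]].
- case: ((v != w) && _) => [/(_ isT) ds|_]; last by exists q; split=> // d; rewrite hq /=; split=> [[]|].
  move: hd0 hq; case: (has (rod_on e) cs) => /=.
    by move=> dq hq; exists q; split=> // d; rewrite hq -dq; split=> [[]|->].
  case: (has (touches e) cs) => hd0 hq.
    exists (Num.min q s); split=> [|d]; first by rewrite lt_min q0.
    by rewrite hq le_min; split=> [[/(_ isT) -> ->]|/andP[-> ->]].
  by exists s; split=> // d; rewrite hq; split=> [[/(_ isT)]|->].
Qed.

Lemma set2_eq (v w v' w' : V) : [set v; w]%SET = [set v'; w']%SET ->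
  v != w -> (v = v' /\ w = w') \/ (v = w' /\ w = v').
Proof.
move=> e vw; have := set22 v w; have := set21 v w; rewrite e !inE.
by move=> /orP[] /eqP vE /orP[] /eqP wE; [|left|right|]; rewrite // vE wE eqxx in vw.
Qed.

(** A known solution [phi0] lets the system be sorted by vertex and by edge: it records the
    prescribed positions and rules out rods from a vertex to itself, while a cable from a vertex to
    itself holds trivially. *)
Lemma sat_edges cs phi0 phi : every (@cpos V) cs -> sat phi0 cs ->
  sat phi cs <-> (forall v, has (is_fix v) cs -> phi v = phi0 v) /\
    (forall v w, v != w -> every (edge_ok [set v; w]%SET (sqn (phi v - phi w))) cs).
Proof.
rewrite /sat; elim: cs => [_ _|c cs IH] /=; first by split.
move=> [c0 /IH{}IH] [okc /IH{}IH]; rewrite IH.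
case: c c0 okc => [v u|v w s|v w s] /= c0 okc.
- split=> [[vu [h1 h2]]|[h1 h2]].
    split=> [v' /orP[/eqP ->|]|v' w' vw]; [by rewrite vu|exact: h1|].
    by split=> //; exact: h2.
  split; first by rewrite h1 ?eqxx.
  by split=> [v' hv|v' w' vw]; [apply: h1; rewrite hv orbT|have [] := h2 v' w' vw].
- split=> [[h [h1 h2]]|[h1 h2]].
    split=> // v' w' vw'; split; last exact: h2.
    by move=> /andP[vw /eqP /set2_eq/(_ vw')[[-> ->]|[-> ->]]]; rewrite ?h// sqnB_sym.
  split; last by split=> // v' w' /h2[].
  have [e|vw] := eqVneq v w; last by have [] := h2 v w vw; rewrite vw eqxx => /(_ isT).
  by move: c0; rewrite -okc e subrr /sqn /dot big1 ?ltxx// => k _; rewrite mxE mul0r.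
- split=> [[h [h1 h2]]|[h1 h2]].
    split=> // v' w' vw'; split; last exact: h2.
    by move=> /andP[vw /eqP /set2_eq/(_ vw')[[-> ->]|[-> ->]]]; rewrite ?h// sqnB_sym.
  split; last by split=> // v' w' /h2[].
  have [e|vw] := eqVneq v w; last by have [] := h2 v w vw; rewrite vw eqxx => /(_ isT).
  rewrite e subrr /sqn /dot big1 ?(ltW c0)// => k _; by rewrite mxE mul0r.
Qed.

Lemma touches_card2 e cs : has (touches e) cs -> #|e| = 2%N.
Proof.
elim: cs => [|c cs IH] //= /orP[|//].
by case: c => //= v w s /andP[vw /eqP ->]; rewrite cards2 vw.
Qed.

Lemma linkage_of_constraints (v0 v1 : V) cs : v0 != v1 -> every (@cpos V) cs ->
  exists L : cabled_linkage R n V,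
  forall phi : V * 'I_n -> R, config_space L phi <-> sat (rowf phi) cs.
Proof.
move=> v01 pos; have [[phi0 h0]|none] := pselect (exists phi0, sat phi0 cs); last first.
  (* An unsolvable system is represented by two vertices fixed at the same point and joined by a rod
     of length 1: its configuration space is empty. *)
  have c2 e : e \in [set [set v0; v1]%SET]%SET -> #|e| = 2%N.
    by rewrite inE => /eqP ->; rewrite cards2 v01.
  exists (@CabledLinkage R n V [set [set v0; v1]]%SET (fun=> 1) [set v0; v1]%SET
    (fun _ _ => 0) finset.set0 c2 (fun _ _ => ltr01) (finset.sub0set _)) => phi; split; last first.
    by move=> h; case: none; exists (rowf phi).
  move=> [/= h1 /(_ v0 v1)]; rewrite !inE eqxx => /(_ isT).
  rewrite vdistE (_ : rowf phi v0 - rowf phi v1 = 0) /sqn /dot.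
    by rewrite big1 ?sqrtr0 1?eq_sym ?oner_eq0// => k _; rewrite mxE mul0r.
  by apply/rowP => i; rewrite !mxE !h1 ?subrr// !inE eqxx ?orbT.
have [_ ok0] := proj1 (sat_edges phi0 pos h0) h0.
have ex e : exists q, 0 < q /\ (has (touches e) cs -> forall d, every (edge_ok e d) cs <->
    if has (rod_on e) cs then d = q else is_true (d <= q)).
  have [he|he] := boolP (has (touches e) cs); last by exists 1.
  have /eqP/cards2P[v [w [vw eE]]] := touches_card2 he.
  have [q [q0 hq]] := merge_edge pos (ok0 v w vw).
  by exists q; split=> // _ d; rewrite eE hq -eE he.
have [len hl] := choice ex.
have len0 e : 0 < len e by have [] := hl e.
have hlen e := proj2 (hl e).
pose E := [set e | has (touches e) cs]%SET.
pose F := [set e in E | ~~ has (rod_on e) cs]%SET.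
have E2 e : e \in E -> #|e| = 2%N by rewrite inE; exact: touches_card2.
have FE : F \subset E by apply/fintype.subsetP => e; rewrite inE => /andP[].
exists (@CabledLinkage R n V E (fun e => Num.sqrt (len e)) [set v | has (is_fix v) cs]%SET
  (fun v i => phi0 v 0 i) F E2 (fun e _ => etrans (sqrtr_gt0 _) (len0 e)) FE) => phi.
rewrite (sat_edges _ pos h0) /config_space /=.
have P1 : (forall v, v \in [set v | has (is_fix v) cs]%SET -> forall i, phi (v, i) = phi0 v 0 i) <->
    (forall v, has (is_fix v) cs -> rowf phi v = phi0 v).
  split=> h v; first by move=> hv; apply/rowP => i; rewrite mxE h// inE.
  by rewrite inE => /h e i; rewrite -e mxE.
rewrite P1.
have P2 v w (d := sqn (rowf phi v - rowf phi w)) : v != w ->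
    every (edge_ok [set v; w]%SET d) cs <-> ([set v; w]%SET \in E ->
    if [set v; w]%SET \in F then vdist phi v w <= Num.sqrt (len [set v; w]%SET)
    else vdist phi v w == Num.sqrt (len [set v; w]%SET)).
  move=> vw; rewrite !inE vdistE; have [he|he] := boolP (has (touches _) cs); last first.
    split=> // _; elim: cs he {P1 pos h0 ok0 ex len hl len0 hlen E F E2 FE} => [|c cs IH] //=.
    rewrite negb_or => /andP[he /IH h]; split=> //.
    by case: c he => //= v' w' s /negbTE ->.
  rewrite (hlen _ he) /=; case: (has (rod_on _) cs) => /=.
    rewrite eqr_sqrt ?sqn_ge0 ?(ltW (len0 _))//.
    by split=> [e _|/(_ isT)/eqP//]; apply/eqP.
  by rewrite ler_sqrt ?(ltW (len0 _))//; split=> [e _|/(_ isT)].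
split=> -[h1 h2]; split=> // v w; first by move=> vw; apply/(P2 v w vw); exact: h2.
move=> vwE; have vw : v != w by have := E2 _ vwE; rewrite cards2; case: (v != w).
exact: (proj1 (P2 v w vw) (h2 v w vw)).
Qed.

End LinkageOfConstraints.

(** * The linkage of a compact quasialgebraic set *)

Section FinalCircuit.
Variables (R : realType) (n j : nat) (o i : 'I_n).
Hypothesis oi : o != i.
Local Notation vec := 'rV[R]_n.
Local Notation input := ('I_j * 'I_n -> R).

Lemma quasialgebraic_circuit (X : set input) : compact_set X -> quasialgebraic X ->
  exists (B : R) (gs : seq (input -> vec)) (sys : seq (constr R n nat)),
    [/\ every (vana B) gs, (2 <= size gs)%N, every (cwf (j + size gs)) sys,
        (forall x, X x -> inbox B x) &
        forall x ws, size ws = size gs ->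
          sat (nth 0 (inputv x ++ ws)) sys <-> X x /\ ws = values gs x].
Proof.
move=> cX [ps [qs XE]]; have [M M0 hM] := compact_set_bounded cX.
(* Cables of squared length [s0] to the origin hold on all of [X]; since [s0 >= 1], they also force
   every coordinate to satisfy [x^2 <= s0 < B^2], that is, they put the input into the box. *)
pose s0 := n%:R * M ^+ 2 + 1; pose B := s0 + M + 1.
have s01 : 1 <= s0 by rewrite lerDr mulr_ge0// sqr_ge0.
have inX x : X x -> forall a, sqn (\row_k x (a, k) : vec) <= s0.
  move=> Xx a; apply: (@le_trans _ _ (n%:R * M ^+ 2)); last by rewrite lerDl.
  rewrite -[n in n%:R]card_ord -sum1_card natr_sum mulr_suml; apply: ler_sum => k _.
  rewrite mul1r !mxE -expr2 -real_normK ?num_real//.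
  by rewrite lerXn2r ?nnegrE// hM.
have in_box x : (forall a, sqn (\row_k x (a, k) : vec) <= s0) -> inbox B x.
  move=> h [a k]; have := le_trans (coord_sqr_le _ k) (h a); rewrite mxE => h'.
  rewrite -(ger0_norm (_ : 0 <= B)); last by rewrite /B; lra.
  rewrite -ltr_sqr ?nnegrE// !real_normK ?num_real//; apply: (le_lt_trans h').
  by rewrite /B; nra.
pose F (p : mpoly.mpoly #|{: 'I_j * 'I_n}| R) (x : input) : vec := peval p x *: unitv R o.
have cF p : computable B (F p) by exact: scal_poly oi p.
(* A cable of length [K] from [q e_o] to [K e_o] means [0 <= q <= 2 K]; with [K] bounding [q] on the
   box, only [0 <= q] remains. *)
have [K [K0 hK]] : exists K, 0 < K /\ forall q, q \in qs -> forall x, inbox B x -> peval q x <= K.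
  elim: (qs) => [|q s [K [K0 hK]]]; first by exists 1.
  have [_ [L hL]] := computable_good (cF q).
  exists (Num.max K (L + 1)); split; first by rewrite lt_max K0.
  move=> q'; rewrite inE => /orP[/eqP ->|/hK{}hK] x xB; rewrite le_max; apply/orP;
    [right|by left; exact: hK].
  have := hL x xB; rewrite sqnZ sqn_unit mulr1.
  by move: (peval q x) => y; nra.
pose args := [seq F p | p <- ps] ++ [seq F q | q <- qs].
have hargs : every (computable B) args.
  by apply/every_cat; split; apply/every_map/(every_nth 0) => *; exact: cF.
have [gs [ks [[ana_gs [sys [wsys hsys]]] sks ks_lt hks]]] :=
  available_all (circuit_nil n j B) hargs.
rewrite cat0s in ana_gs wsys hsys ks_lt hks.
have sargs : size args = (size ps + size qs)%N by rewrite size_cat !size_map.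
rewrite sargs in ks_lt hks sks.
have vp x t : (t < size ps)%N -> (values args x)`_t = peval (nth 0 ps t) x *: unitv R o.
  by move=> tp; rewrite values_cat nth_cat size_values size_map tp /values -map_comp (nth_map 0).
have vq x t : (t < size qs)%N ->
    (values args x)`_(size ps + t) = peval (nth 0 qs t) x *: unitv R o.
  move=> tq; rewrite values_cat nth_cat size_values size_map ltnNge leq_addr/= addKn.
  by rewrite /values -map_comp (nth_map 0).
(* Two constant vertices, at the origin and at [K e_o], serve as anchors. They also provide the two
   distinct vertices from which an empty configuration space can be built. *)
pose P0 := (j + size gs)%N; pose P1 := P0.+1.
pose csO := [:: Fix P0 (0 : vec); Fix P1 (K *: unitv R o)].
pose csX := [seq Cable n a P0 s0 | a <- iota 0 j].
pose csP := [seq Fix (nth 0%N ks t) (0 : vec) | t <- iota 0 (size ps)].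
pose csQ := [seq Cable n (nth 0%N ks (size ps + t)) P1 (K ^+ 2) | t <- iota 0 (size qs)].
exists B, (gs ++ [:: fun=> 0; fun=> K *: unitv R o]), (sys ++ csO ++ csX ++ csP ++ csQ).
have sz : size (gs ++ [:: fun=> 0; fun=> K *: unitv R o]) = (size gs + 2)%N.
  by rewrite size_cat.
split.
- apply/every_cat; split=> //=.
  by split; [|split]=> // p pB k; exact: ana_const.
- by rewrite sz addn2.
- have ltP0 t : (t < size ps + size qs)%N -> (nth 0%N ks t < j + (size gs + 2))%N.
    by move=> /ks_lt h; rewrite addnA ltn_addr.
  rewrite sz; do !(apply/every_cat; split).
  + by apply: every_imp wsys => c; apply: cwf_weaken; rewrite addnA leq_addr.
  + by rewrite /= /P1 /P0 !addnA !addn2; do !split.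
  + apply/every_map/everyP => a; rewrite mem_iota/= add0n => aj.
    by split; [rewrite ltn_addr|rewrite /P0 addnA addn2 ltnW|lra].
  + apply/every_map/everyP => t; rewrite mem_iota/= add0n => tp.
    by apply: ltP0; rewrite ltn_addr.
  + apply/every_map/everyP => t; rewrite mem_iota/= add0n => tq.
    split; [by apply: ltP0; rewrite ltn_add2l|by rewrite /P1 /P0 addnA addn2|].
    exact: exprn_gt0.
- by move=> x Xx; apply: in_box => a; exact: inX.
move=> x ws; rewrite sz => sws.
have [ws1 [u [v [s1 ->]]]] : exists ws1 u v, size ws1 = size gs /\ ws = ws1 ++ [:: u; v].
  exists (take (size gs) ws), (nth 0 ws (size gs)), (nth 0 ws (size gs).+1).
  rewrite size_takel ?sws ?leq_addr//; split=> //.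
  rewrite -[LHS](cat_take_drop (size gs)); congr (_ ++ _).
  have : size (drop (size gs) ws) = 2%N by rewrite size_drop sws addKn.
  rewrite -[size gs]addn0 -addnS -!nth_drop addn0.
  by case: (drop _ ws) => [|a [|b []]].
have nlt t : (t < P0)%N -> nth 0 (inputv x ++ ws1 ++ [:: u; v]) t = nth 0 (inputv x ++ ws1) t.
  by move=> tP; rewrite catA nth_cat size_cat size_inputv s1 tP.
have n0 : nth 0 (inputv x ++ ws1 ++ [:: u; v]) P0 = u.
  by rewrite catA nth_cat size_cat size_inputv s1 ltnn subnn.
have n1 : nth 0 (inputv x ++ ws1 ++ [:: u; v]) P1 = v.
  by rewrite catA nth_cat size_cat size_inputv s1 ltnNge leqnSn/= subSnn.
have nin (a : 'I_j) : nth 0 (inputv x ++ ws1 ++ [:: u; v]) a = \row_k x (a, k).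
  rewrite nth_cat size_inputv ltn_ord (nth_map a) ?size_enum_ord//.
  by rewrite nth_ord_enum.
set phi := nth 0 (inputv x ++ ws1 ++ [:: u; v]) in nlt n0 n1 nin *.
have E1 : every (holds phi) sys <-> sat (nth 0 (inputv x ++ ws1)) sys.
  by apply: (sat_local (m := P0)).
have EX : every (holds phi) csX <-> forall a : 'I_j, sqn ((\row_k x (a, k)) - u) <= s0.
  rewrite every_map everyP; split=> h a.
    by have := h a; rewrite mem_iota ltn_ord /holds nin n0 => /(_ isT).
  rewrite mem_iota/= add0n => aj; have := h (Ordinal aj).
  by rewrite /holds n0 -nin.
have EP : every (holds phi) csP <-> forall t, (t < size ps)%N -> phi (nth 0%N ks t) = 0.
  by rewrite every_map everyP; split=> h t; have := h t; rewrite mem_iota.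
have EQ : every (holds phi) csQ <-> forall t, (t < size qs)%N ->
    sqn (phi (nth 0%N ks (size ps + t)%N) - v) <= K ^+ 2.
  rewrite every_map everyP; split=> h t; have := h t; rewrite mem_iota /holds n1//.
rewrite /sat !every_cat E1 EX EP EQ.
have EO : every (holds phi) csO <-> u = 0 /\ v = K *: unitv R o.
  by rewrite /csO /every /holds n0 n1; tauto.
rewrite EO values_cat.
have ksP t : (t < size ps)%N -> (nth 0%N ks t < P0)%N.
  by move=> tp; apply: ks_lt; rewrite ltn_addr.
have ksQ t : (t < size qs)%N -> (nth 0%N ks (size ps + t) < P0)%N.
  by move=> tp; apply: ks_lt; rewrite ltn_add2l.
split=> [[h1 [[u0 v0] [h3 [h4 h5]]]]|[Xx /eqP]].
  have xB : inbox B x by apply: in_box => a; have := h3 a; rewrite u0 subr0.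
  have w1 := proj1 (hsys x xB ws1 s1) h1.
  rewrite u0 v0 w1; split=> //; rewrite XE; split=> [p /(nthP 0)[t tp <-]|q /(nthP 0)[t tq <-]].
    have := h4 t tp; rewrite nlt ?ksP// w1 hks ?ltn_addr// vp// => /eqP.
    rewrite scaler_eq0 => /orP[/eqP//|/eqP uo].
    by have := sqn_unit R o; rewrite uo /sqn /dot big1 => [/eqP|k _]; rewrite ?mxE ?mul0r// eq_sym oner_eq0.
  have := h5 t tq; rewrite nlt ?ksQ// w1 hks ?ltn_add2l// vq// v0 -scalerBl sqnZ sqn_unit mulr1.
  by move: (peval _ x) => y; nra.
have xB : inbox B x by apply: in_box => a; exact: inX.
rewrite eqseq_cat ?size_values// => /andP[/eqP w1 /eqP[u0 v0]].
split; first exact/(hsys x xB ws1 s1).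
split=> //; split; first by move=> a; rewrite u0 subr0; exact: inX.
move: (Xx); rewrite {1}XE => -[hp hq]; split=> t ht.
  by rewrite nlt ?ksP// w1 hks ?ltn_addr// vp// hp ?scale0r// mem_nth.
rewrite nlt ?ksQ// w1 hks ?ltn_add2l// vq// v0 -scalerBl sqnZ sqn_unit mulr1.
have := hq _ (mem_nth 0 ht); have := hK _ (mem_nth 0 ht) x xB.
by move: (peval _ x) => y; nra.
Qed.

End FinalCircuit.

Section Realization.
Variable R : realType.

(** The same coefficients, with exponents extended by zero to the additional variables. *)
Lemma ana_inl (J K : finType) (f : (J -> R) -> R) (p : J + K -> R) :
  ana (fun q => p (inl q)) f -> ana p (fun z => f (fun q => z (inl q))).
Proof.
move=> [r [C [r0 [c [cC hc]]]]]; exists r, C; split=> //.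
pose pi (a : {ffun J -> nat}) : {ffun J + K -> nat} :=
  [ffun q => if q is inl q' then a q' else 0%N].
have E (h : J + K -> R) a : monom h (pi a) = monom (fun q => h (inl q)) a.
  rewrite /monom big_sumType /= [X in _ * X]big1 ?mulr1 => [|q _].
    by apply: eq_bigr => q _; rewrite ffunE.
  by rewrite ffunE expr0.
apply: (@psn_regroup _ _ _ _ _ _ _ pi c) => // [|x xp].
  by apply: abs_le_mono cC => a; rewrite E.
apply: has_sum_eq (hc (fun q => x (inl q)) (fun q => xp (inl q))) => a.
by rewrite E.
Qed.

Variables (n j k m1 : nat).
Local Notation vec := 'rV[R]_n.
Local Notation input := ('I_j * 'I_n -> R).
Local Notation V := ('I_j + 'I_(k + m1.+1))%type.
Local Notation param := (('I_j * 'I_n + 'I_k * 'I_n)%type -> R).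
Implicit Types (phi : V * 'I_n -> R) (z : param) (gs : seq (input -> vec)).

(** Numbers below [j] are inputs, the following ones forced vertices. The block of [k] vertices
    between them is skipped: no constraint touches it, so these vertices move freely and supply the
    factor [(R^n)^k]. *)
Definition vertex_of (v : nat) : V :=
  if insub v is Some a then inl a else inr (rshift k (inord (v - j))).

Definition input_of phi : input := fun q => phi (inl q.1, q.2).
Definition forced_of phi : seq vec :=
  [seq rowf phi (inr (rshift k b)) | b <- enum 'I_m1.+1].
Definition param_of phi : param := fun s =>
  match s with inl (a, i) => phi (inl a, i) | inr (c, i) => phi (inr (lshift _ c), i) end.
Definition forced_map gs z (p : 'I_(k + m1.+1) * 'I_n) : R :=
  match fintype.split p.1 with
  | inl c => z (inr (c, p.2))
  | inr b => (values gs (fun q => z (inl q)))`_b 0 p.2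
  end.

Lemma sat_vertex_of phi (sys : seq (constr R n nat)) : every (cwf (j + m1.+1)) sys ->
  sat (rowf phi) (map (cmap vertex_of) sys) <->
  sat (nth 0 (inputv (input_of phi) ++ forced_of phi)) sys.
Proof.
move=> wsys; rewrite sat_cmap; apply: (sat_local (m := j + m1.+1)) => // v vlt /=.
rewrite nth_cat size_inputv /vertex_of; case: insubP => [a vj va|].
  rewrite vj (nth_map a) ?size_enum_ord//; apply/rowP => i.
  by rewrite !mxE /input_of /=; congr (phi (inl _, _)); apply: val_inj; rewrite /= nth_enum_ord.
rewrite -leqNgt => jv; rewrite ltnNge jv /=.
have vj : (v - j < m1.+1)%N by rewrite ltn_subLR.
rewrite (nth_map ord0) ?size_enum_ord//; congr (rowf phi (inr (rshift k _))).
by apply: val_inj; rewrite /= nth_enum_ord// inordK.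
Qed.

Lemma forced_map_lshift gs z c i : forced_map gs z (lshift m1.+1 c, i) = z (inr (c, i)).
Proof.
rewrite /forced_map /=; case: (split_ordP (lshift m1.+1 c)) => [c' /lshift_inj ->//|b].
by move/eqP; rewrite eq_lrshift.
Qed.

Lemma forced_map_rshift gs z b i :
  forced_map gs z (rshift k b, i) = (values gs (fun q => z (inl q)))`_b 0 i.
Proof.
rewrite /forced_map /=; case: (split_ordP (rshift k b)) => [c|b' /rshift_inj ->//].
by move/eqP; rewrite eq_rlshift.
Qed.

Lemma param_of_graph_map gs z : param_of (graph_map (forced_map gs) z) = z.
Proof.
by apply/funext => -[[a i]|[c i]] //=; rewrite forced_map_lshift.
Qed.

Lemma forced_of_graph_map gs z : size gs = m1.+1 ->
  forced_of (graph_map (forced_map gs) z) = values gs (fun q => z (inl q)).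
Proof.
move=> sgs; apply: (@eq_from_nth _ 0); first by rewrite size_map size_enum_ord size_values.
move=> b; rewrite size_map size_enum_ord => bm.
rewrite (nth_map ord0) ?size_enum_ord//; apply/rowP => i.
by rewrite mxE /= forced_map_rshift nth_enum_ord.
Qed.

Lemma graph_map_param_of gs phi :
  forced_of phi = values gs (input_of phi) ->
  graph_map (forced_map gs) (param_of phi) = phi.
Proof.
move=> e; apply/funext => -[[a|b] i] //=.
rewrite -[b in LHS]splitK -[b in RHS]splitK; case: (fintype.split b) => [c|b'] /=.
  by rewrite forced_map_lshift.
rewrite forced_map_rshift.
have -> : (fun q => param_of phi (inl q)) = input_of phi by apply/funext => -[].
by rewrite -e (nth_map ord0) ?size_enum_ord// mxE nth_ord_enum.
Qed.

Lemma ana_forced_map (B : R) gs z p : every (vana B) gs ->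
  inbox B (fun q => z (inl q)) -> ana z (fun z => forced_map gs z p).
Proof.
case: p => b i hgs zB; rewrite /forced_map /=; case: (fintype.split b) => [c|b'].
  exact: ana_coord.
apply: (ana_inl (f := fun x => (values gs x)`_b' 0 i)).
case: (ltnP b' (size gs)) => hb.
  have := proj1 (every_nth (fun=> 0) _ _) hgs b' hb _ zB i.
  by apply: ana_ext => x; rewrite /values (nth_map (fun=> 0)).
apply: ana_ext (ana_const _ 0) => x.
by rewrite nth_default ?size_values// mxE.
Qed.

End Realization.

Lemma analytic_coordinates (R : realType) (I J : finType) (X : set (I -> R)) (h : J -> I) :
  restr_analytic X (fun x q => x (h q)).
Proof.
exists setT, (fun x q => x (h q)); split=> //; first exact: (@openT {ptws I -> R}).
by move=> p _ q; apply: ana_analytic_at; exact: ana_coord.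
Qed.

Lemma quasialgebraic_realization (R : realType) (n : nat) (hn : (2 <= n)%N) (j k : nat)
    (X : set ('I_j * 'I_n -> R)) : compact_set X -> quasialgebraic X ->
  exists (m : nat) (L : cabled_linkage R n ('I_j + 'I_m)%type)
         (alpha : ((('I_j * 'I_n) + ('I_k * 'I_n))%type -> R) -> ('I_m * 'I_n -> R)),
  [/\ exists f, analytic_isomorphism (config_space L) (prod_space n k X) f,
      restr_analytic (prod_space n k X) alpha,
      config_space L = graph_map alpha @` prod_space n k X &
      analytic_isomorphism (prod_space n k X) (config_space L) (graph_map alpha)].
Proof.
move=> cX qX; pose o := Ordinal (ltnW hn); pose i := Ordinal hn.
have oi : o != i by [].
have [B [gs [sys [hgs gs2 wsys XB hsys]]]] := quasialgebraic_circuit oi cX qX.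
case sgs : (size gs) gs2 wsys => [//|m1] m2 wsys.
pose v0 : 'I_j + 'I_(k + m1.+1) := inr (rshift k ord0).
pose v1 : 'I_j + 'I_(k + m1.+1) := inr (rshift k ord_max).
have v01 : v0 != v1.
  apply/eqP => -[] /eqP; rewrite /= addn0 -{1}[k]addn0 eqn_add2l => /eqP m0.
  by rewrite -m0 in m2.
have pos : every (@cpos R n ('I_j + 'I_(k + m1.+1))%type) (map (cmap (vertex_of j k m1)) sys).
  by apply/every_map; apply: every_imp wsys => -[v u|v w s|v w s] //= [].
have [L hL] := linkage_of_constraints v01 pos.
have {}hL phi : config_space L phi <->
    X (input_of phi) /\ forced_of phi = values gs (input_of phi).
  by rewrite hL sat_vertex_of// hsys// sgs size_map size_enum_ord.
pose alpha := @forced_map R n j k m1 gs.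
have a_in z : prod_space n k X z -> config_space L (graph_map alpha z).
  move=> Xz; apply/hL; rewrite forced_of_graph_map//.
  have -> : input_of (graph_map alpha z) = (fun q => z (inl q)) by apply/funext => -[].
  by split.
have p_in phi : config_space L phi -> prod_space n k X (param_of phi).
  move=> /hL[Xphi _]; rewrite /prod_space /=.
  by have -> : (fun q => param_of phi (inl q)) = input_of phi by apply/funext => -[].
have pK z : prod_space n k X z -> param_of (graph_map alpha z) = z.
  by move=> _; exact: param_of_graph_map.
have aK phi : config_space L phi -> graph_map alpha (param_of phi) = phi.
  by move=> /hL[_]; exact: graph_map_param_of.
(* Only the coordinates of [x] are confined to the box; [y] is unrestricted. *)
pose U := [set z : ('I_j * 'I_n + 'I_k * 'I_n)%type -> R |
  forall s, (if s is inl _ then true else false) -> `|z s| < B].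
have oU : open_set U by exact: open_box.
have XU : prod_space n k X `<=` U by move=> z /XB h [q|//] _; exact: h.
have UB z : U z -> inbox B (fun q => z (inl q)) by move=> h q; exact: h.
have r_alpha : restr_analytic (prod_space n k X) alpha.
  exists U, alpha; split=> // z /UB zB p; apply: ana_analytic_at.
  exact: ana_forced_map zB.
have r_graph : restr_analytic (prod_space n k X) (graph_map alpha).
  exists U, (graph_map alpha); split=> // z /UB zB [[a|b] l]; apply: ana_analytic_at.
    exact: ana_coord.
  exact: ana_forced_map zB.
have r_param : restr_analytic (config_space L) (@param_of R n j k m1).
  pose h (s : 'I_j * 'I_n + 'I_k * 'I_n) : ('I_j + 'I_(k + m1.+1)) * 'I_n :=
    match s with inl (a, i) => (inl a, i) | inr (c, i) => (inr (lshift _ c), i) end.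
  have [U' [F [? ? ? FE]]] := analytic_coordinates (config_space L) h.
  exists U', F; split=> // phi /FE ->.
  by apply/funext => -[[a l]|[c l]].
exists (k + m1.+1)%N, L, alpha; split=> //.
- exists (@param_of R n j k m1); split=> //.
  by exists (graph_map alpha); split.
- apply/seteqP; split=> phi; last by move=> [z Xz <-]; exact: a_in.
  by move=> hphi; exists (param_of phi); [exact: p_in|exact: aK].
- by split=> //; exists (@param_of R n j k m1); split.
Qed.

(** * Polynomial functions and quasialgebraic sets *)

Section PolynomialFunctions.
Variables (R : realType) (I : finType).
Implicit Types (g h : (I -> R) -> R) (X Y : set (I -> R)).

Definition polyfun g := exists p : mpoly.mpoly #|I| R, forall x, peval p x = g x.

Lemma polyfun_const a : polyfun (fun=> a).
Proof. by exists (mpoly.mpolyC _ a) => x; rewrite /peval mpoly.mevalC. Qed.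

Lemma polyfun_coord i : polyfun (fun x => x i).
Proof.
exists (mpoly.mpolyX _ (mpoly.mnm1 (enum_rank i))) => x.
by rewrite /peval mpoly.mevalXU enum_rankK.
Qed.

Lemma polyfunD g h : polyfun g -> polyfun h -> polyfun (fun x => g x + h x).
Proof. by move=> [p hp] [q hq]; exists (p + q) => x; rewrite -hp -hq /peval mpoly.mevalD. Qed.

Lemma polyfunM g h : polyfun g -> polyfun h -> polyfun (fun x => g x * h x).
Proof. by move=> [p hp] [q hq]; exists (p * q) => x; rewrite -hp -hq /peval mpoly.mevalM. Qed.

Lemma polyfun_eq g h : g =1 h -> polyfun g -> polyfun h.
Proof. by move=> /funext ->. Qed.

Lemma polyfunB g h : polyfun g -> polyfun h -> polyfun (fun x => g x - h x).
Proof.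
move=> pg ph; apply: polyfun_eq (polyfunD pg (polyfunM (polyfun_const (-1)) ph)) => x.
by rewrite mulN1r.
Qed.

Lemma polyfun_sum (T : Type) (s : seq T) (F : T -> (I -> R) -> R) :
  (forall t, polyfun (F t)) -> polyfun (fun x => \sum_(t <- s) F t x).
Proof.
move=> h; elim: s => [|t s IH].
  by apply: polyfun_eq (polyfun_const 0) => x; rewrite big_nil.
by apply: polyfun_eq (polyfunD (h t) IH) => x; rewrite big_cons.
Qed.

Lemma polyfun_entire_rational (J : finType) (X : set (I -> R)) (f : (I -> R) -> J -> R) :
  (forall q, polyfun (fun x => f x q)) -> restr_entire_rational X f.
Proof.
move=> h; exists f; split=> // q; have [p hp] := h q.
exists p, (mpoly.mpolyC _ 1); rewrite /peval.
by split=> x; rewrite mpoly.mevalC ?oner_eq0// divr1 -hp.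
Qed.

Lemma qa_zero g : polyfun g -> quasialgebraic [set x | g x = 0].
Proof.
move=> [p hp]; exists [:: p], [::]; apply/seteqP; split=> x /=.
  by move=> gx; split=> // p'; rewrite inE => /eqP ->; rewrite hp.
by move=> [/(_ p)]; rewrite mem_head hp => /(_ isT).
Qed.

Lemma qa_nneg g : polyfun g -> quasialgebraic [set x | 0 <= g x].
Proof.
move=> [p hp]; exists [::], [:: p]; apply/seteqP; split=> x /=.
  by move=> gx; split=> // p'; rewrite inE => /eqP ->; rewrite hp.
by move=> [_ /(_ p)]; rewrite mem_head hp => /(_ isT).
Qed.

Lemma qaT : quasialgebraic [set: I -> R].
Proof. by exists [::], [::]; apply/seteqP; split=> x. Qed.

Lemma qaI X Y : quasialgebraic X -> quasialgebraic Y -> quasialgebraic (X `&` Y).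
Proof.
move=> [p1 [q1 ->]] [p2 [q2 ->]]; exists (p1 ++ p2), (q1 ++ q2).
apply/seteqP; split=> x /=.
  move=> [[h1 h2] [h3 h4]]; split=> p; rewrite mem_cat => /orP[]; auto.
move=> [h1 h2]; split; split=> p hp; (apply: h1 || apply: h2);
  by rewrite mem_cat hp ?orbT.
Qed.

Lemma qa_forall (T : finType) (A : T -> set (I -> R)) :
  (forall t, quasialgebraic (A t)) -> quasialgebraic [set x | forall t, A t x].
Proof.
move=> hA; suff h (s : seq T) : quasialgebraic [set x | forall t, t \in s -> A t x].
  have := h (enum T); congr quasialgebraic; apply/seteqP; split=> x /= h' t //.
  by apply: h'; rewrite mem_enum.
elim: s => [|t s IH].
  by have := qaT; congr quasialgebraic; apply/seteqP; split=> x.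
have := qaI (hA t) IH; congr quasialgebraic; apply/seteqP; split=> x /=.
  by move=> [h1 h2] t'; rewrite inE => /orP[/eqP ->|/h2].
move=> h; split; first by apply: h; rewrite mem_head.
by move=> t' t's; apply: h; rewrite inE t's orbT.
Qed.

Lemma qa_guard (b : bool) X : quasialgebraic X -> quasialgebraic [set x | b -> X x].
Proof.
case: b => qX; first by have := qX; congr quasialgebraic; apply/seteqP; split=> x /=; auto.
by have := qaT; congr quasialgebraic; apply/seteqP; split=> x.
Qed.

Lemma continuous_sum_fun (T : topologicalType) (A : Type) (s : seq A) (F : A -> T -> R) :
  (forall a, continuous (F a)) -> continuous (fun x => \sum_(a <- s) F a x).
Proof.
move=> h; elim: s => [|a s IH].
  have -> : (fun x => \sum_(a <- [::]) F a x) = (fun=> 0) by apply/funext => x; rewrite big_nil.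
  exact: cst_continuous.
have -> : (fun x => \sum_(a <- a :: s) F a x) = (fun x => F a x + \sum_(a <- s) F a x).
  by apply/funext => x; rewrite big_cons.
by move=> x; apply: continuousD (h a x) (IH x).
Qed.

Lemma continuous_prod_fun (T : topologicalType) (A : Type) (s : seq A) (F : A -> T -> R) :
  (forall a, continuous (F a)) -> continuous (fun x => \prod_(a <- s) F a x).
Proof.
move=> h; elim: s => [|a s IH].
  have -> : (fun x => \prod_(a <- [::]) F a x) = (fun=> 1) by apply/funext => x; rewrite big_nil.
  exact: cst_continuous.
have -> : (fun x => \prod_(a <- a :: s) F a x) = (fun x => F a x * \prod_(a <- s) F a x).
  by apply/funext => x; rewrite big_cons.
by move=> x; apply: continuousM (h a x) (IH x).
Qed.

Lemma peval_continuous (p : mpoly.mpoly #|I| R) :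
  continuous (peval p : {ptws I -> R} -> R).
Proof.
have -> : (peval p : {ptws I -> R} -> R) = fun x =>
    \sum_(m <- mpoly.msupp p) mpoly.mcoeff m p * \prod_(k < #|I|) x (enum_val k) ^+ m k.
  by apply/funext => x; rewrite /peval mpoly.mevalE.
apply: (@continuous_sum_fun {ptws I -> R}) => m x.
apply: (@continuousM R {ptws I -> R} (fun=> mpoly.mcoeff m p)).
  exact: (@cst_continuous {ptws I -> R} R).
move: x; apply: (@continuous_prod_fun {ptws I -> R}) => k x.
apply: (@continuous_comp {ptws I -> R} R R (fun x => x (enum_val k)) (fun y => y ^+ m k)).
  exact: coord_continuous.
exact: exprn_continuous.
Qed.

Lemma qa_compact X (b : R) : quasialgebraic X ->
  (forall x, X x -> forall i, `|x i| <= b) -> compact_set X.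
Proof.
move=> [ps [qs XE]] hb.
suff cl : @closed {ptws I -> R} X.
  exact: (@subclosed_compact {ptws I -> R} X _ cl (@box_compact R I b) hb).
have c0 (p : mpoly.mpoly #|I| R) : closed [set x : {ptws I -> R} | peval p x = 0].
  have := @preimage_closed {ptws I -> R} R (peval p) [set 0 : R].
  by apply=> [x _|]; [exact: peval_continuous|exact: closed_eq].
have c1 (p : mpoly.mpoly #|I| R) : closed [set x : {ptws I -> R} | 0 <= peval p x].
  have := @preimage_closed {ptws I -> R} R (peval p) [set y : R | 0 <= y].
  by apply=> [x _|]; [exact: peval_continuous|exact: closed_ge].
have -> : X = (\bigcap_(p in [set` ps]) [set x | peval p x = 0]) `&`
              (\bigcap_(q in [set` qs]) [set x | 0 <= peval q x]).
  by rewrite XE; apply/seteqP; split=> x /= [h1 h2]; split=> p hp; by [exact: h1|exact: h2].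
by apply: closedI; apply: (@closed_bigI {ptws I -> R}) => p _.
Qed.

End PolynomialFunctions.

(** * Splitting off the translations of the free components *)

Section ConfigurationSpace.
Variables (R : realType) (n : nat) (V : finType) (L : cabled_linkage R n V).
Implicit Types (phi : V * 'I_n -> R) (u v w : V).

Definition component v : {set V} := [set w | connect (ladj L) v w]%SET.
Definition free_components : {set {set V}} :=
  [set C in lcomponents L | [disjoint C & cl_fixed L]]%SET.
Local Notation K := 'I_#|free_components|.

Lemma ladj_sym : ssrbool.symmetric (ladj L).
Proof. by move=> v w; rewrite /ladj finset.setUC. Qed.

Lemma component_eq v w : connect (ladj L) v w -> component v = component w.
Proof.
move=> vw; apply/setP => u; rewrite !inE.
exact: (same_connect (sym_connect_sym ladj_sym) vw).
Qed.

Lemma exists_bases : exists bs : K -> V, forall c, component (bs c) = enum_val c.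
Proof.
have h (c : K) : exists v, component v = enum_val c.
  have := enum_valP c; rewrite inE => /andP[/imsetP[v _ e] _].
  by exists v; rewrite e.
by have [bs hbs] := choice h; exists bs.
Qed.

(** [None] marks the vertices whose component contains a fixed vertex and which therefore cannot be
    translated. *)
Definition class_of v : option K := [pick c : K | enum_val c == component v].

Lemma class_ofP v (c : K) : class_of v = Some c <-> enum_val c = component v.
Proof.
rewrite /class_of; case: pickP => [c' /eqP e|none]; split=> //.
- by case=> <-.
- by rewrite -e => /enum_val_inj ->.
- by move=> e; have := none c; rewrite e eqxx.
Qed.

Lemma class_of_eq v w : connect (ladj L) v w -> class_of v = class_of w.
Proof. by move=> /component_eq e; rewrite /class_of e. Qed.

Lemma class_of_fixed v : v \in cl_fixed L -> class_of v = None.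
Proof.
move=> vF; case e: (class_of v) => [c|] //; move/class_ofP: e => e.
have := enum_valP c; rewrite inE e => /andP[_ /pred0P/(_ v)/=].
by rewrite inE connect0 vF.
Qed.

Lemma class_of_None v : class_of v = None ->
  exists2 w, w \in cl_fixed L & connect (ladj L) w v.
Proof.
rewrite /class_of; case: pickP => // none _.
have : ~~ [disjoint component v & cl_fixed L].
  apply/negP => dis.
  have vF : component v \in free_components by rewrite inE dis andbT; apply: imset_f.
  by have := none (enum_rank_in vF (component v)); rewrite enum_rankK_in// eqxx.
move=> /pred0Pn[w /=]; rewrite inE => /andP[vw wF]; exists w => //.
by rewrite (sym_connect_sym ladj_sym).
Qed.

Definition offset (y : K -> 'I_n -> R) (p : V * 'I_n) : R :=
  if class_of p.1 is Some c then y c p.2 else 0.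

Lemma offset_fixed y v i : v \in cl_fixed L -> offset y (v, i) = 0.
Proof. by move=> vF; rewrite /offset /= class_of_fixed. Qed.

(** Both ends of an edge lie in the same component, so differences along edges do not change; fixed
    vertices do not move. *)
Lemma config_translate phi y :
  config_space L phi -> config_space L (fun p => phi p + offset y p).
Proof.
move=> [h1 h2]; split=> [v vF i|v w vw]; first by rewrite offset_fixed// addr0 h1.
suff -> : vdist (fun p => phi p + offset y p) v w = vdist phi v w by exact: h2.
congr Num.sqrt; apply: eq_bigr => i _; congr (_ ^+ 2).
by rewrite /offset /= (class_of_eq (connect1 vw)); ring.
Qed.

Variable bs : K -> V.
Hypothesis bsP : forall c, component (bs c) = enum_val c.

Lemma class_of_base c : class_of (bs c) = Some c.
Proof. by apply/class_ofP; rewrite bsP. Qed.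

Local Notation coords := 'I_#|{: V * 'I_n}|.

(** The compact factor has to lie in some [R^N] with coordinates numbered by ['I_N], hence the
    enumeration of [V * 'I_n]. *)
Definition unflatten (x : coords -> R) : V * 'I_n -> R := fun p => x (enum_rank p).

Definition based_configurations : set (coords -> R) :=
  [set x | config_space L (unflatten x) /\ forall c i, unflatten x (bs c, i) = 0].

(** Distances and lengths are nonnegative, so they may be compared through their squares, which are
    polynomial. *)
Lemma based_quasialgebraic : quasialgebraic based_configurations.
Proof.
have pc p : polyfun (fun x : coords -> R => unflatten x p) by exact: polyfun_coord.
pose d2 v w (x : coords -> R) := \sum_(i < n) (unflatten x (v, i) - unflatten x (w, i)) ^+ 2.
have pd v w : polyfun (d2 v w).
  apply: polyfun_sum => i; apply: polyfun_eq (polyfunM (polyfunB (pc (v, i)) (pc (w, i)))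
    (polyfunB (pc (v, i)) (pc (w, i)))) => x; by rewrite expr2.
pose l v w := cl_len L [set v; w]%SET.
have q1 : quasialgebraic [set x : coords -> R | forall v, v \in cl_fixed L ->
    forall i, unflatten x (v, i) - cl_mu L v i = 0].
  apply: qa_forall => v; apply: qa_guard; apply: qa_forall => i.
  by apply: qa_zero; apply: polyfunB (pc (v, i)) (polyfun_const _ _).
have q2 : quasialgebraic [set x : coords -> R | forall v w, [set v; w]%SET \in cl_edges L ->
   [set y | [set v; w]%SET \in cl_flex L -> 0 <= l v w ^+ 2 - d2 v w y] x /\
   [set y | [set v; w]%SET \notin cl_flex L -> l v w ^+ 2 - d2 v w y = 0] x].
  apply: qa_forall => v; apply: qa_forall => w; apply: qa_guard; apply: qaI; apply: qa_guard.
    by apply: qa_nneg; exact: polyfunB (polyfun_const _ _) (pd v w).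
  by apply: qa_zero; exact: polyfunB (polyfun_const _ _) (pd v w).
have q3 : quasialgebraic [set x : coords -> R | forall c i, unflatten x (bs c, i) = 0].
  by apply: qa_forall => c; apply: qa_forall => i; exact: qa_zero.
have := qaI (qaI q1 q2) q3; congr quasialgebraic; apply/seteqP.
have d0 v w x : 0 <= d2 v w x by apply: sumr_ge0 => i _; exact: sqr_ge0.
have l0 v w : [set v; w]%SET \in cl_edges L -> Num.sqrt (l v w ^+ 2) = l v w.
  by move=> /cl_len_pos h; rewrite sqrtr_sqr gtr0_norm.
split=> x /= [[h1 h2] h3]; split=> //; split.
- by move=> v vF i; apply/eqP; rewrite -subr_eq0 h1.
- move=> v w vw; have [hf hr] := h2 v w vw; rewrite /vdist -/(d2 v w x) -/(l v w) -(l0 _ _ vw).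
  case: ifPn => [/hf|/hr]; first by rewrite subr_ge0 => h; rewrite ler_sqrt ?sqr_ge0.
  by move=> /eqP; rewrite subr_eq0 => /eqP ->.
- by move=> v vF i; rewrite h1// subrr.
- move=> v w vw; have h := h2 v w vw.
  rewrite /vdist -/(d2 v w x) -/(l v w) -(l0 _ _ vw) in h; move: h.
  case: ifPn => vwF; first rewrite ler_sqrt ?sqr_ge0// => h.
    by split=> //; rewrite subr_ge0.
  rewrite eqr_sqrt ?sqr_ge0// => /eqP ->.
  by split=> //; rewrite subrr.
Qed.

(** Bounds propagate along edges, starting in each component from its base at the origin or from a
    fixed vertex. *)
Lemma based_bounded : exists b, forall x, based_configurations x -> forall q, `|x q| <= b.
Proof.
pose Bd v := exists b, forall x, based_configurations x -> forall i, `|unflatten x (v, i)| <= b.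
have step v w : ladj L v w -> Bd v -> Bd w.
  move=> vw [b hb]; exists (cl_len L [set v; w]%SET + b) => x Xx i.
  have [[_ /(_ v w vw) h] _] := Xx.
  have {}h : vdist (unflatten x) v w <= cl_len L [set v; w]%SET.
    by move: h; case: ifP => // _ /eqP ->.
  have h' : `|unflatten x (v, i) - unflatten x (w, i)| <= vdist (unflatten x) v w.
    rewrite -sqrtr_sqr /vdist ler_sqrt; last by apply: sumr_ge0 => *; exact: sqr_ge0.
    rewrite (bigD1 i)//= lerDl; apply: sumr_ge0 => *; exact: sqr_ge0.
  have := hb x Xx i.
  have := ler_normB (unflatten x (v, i)) (unflatten x (v, i) - unflatten x (w, i)).
  rewrite subKr; lra.
have conn v w : connect (ladj L) v w -> Bd v -> Bd w.
  move=> /connectP[s ps ->]; elim: s v ps => [|u s IH] v //= /andP[vu us] bv.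
  exact: IH us (step _ _ vu bv).
have all_bd v : Bd v.
  case e : (class_of v) => [c|].
    apply: (conn (bs c)).
      move/class_ofP: e => e.
      have : v \in component (bs c) by rewrite bsP e inE connect0.
      by rewrite inE.
    by exists 0 => x [_ h] i; rewrite h normr0.
  have [w wF wv] := class_of_None e; apply: conn wv _.
  exists (\sum_(i < n) `|cl_mu L w i|) => x [[h _] _] i; rewrite h//.
  by rewrite (bigD1 i)//= lerDl sumr_ge0.
have [b hb] := choice all_bd.
exists (\sum_v `|b v|) => x Xx q; rewrite -(enum_valK q); case: (enum_val q) => v i.
apply: (le_trans (hb v x Xx i)); apply: (le_trans (ler_norm _)).
by rewrite (bigD1 v)//= lerDl sumr_ge0.
Qed.

Definition split_translation phi (s : coords + K * 'I_n) : R :=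
  match s with
  | inl q => phi (enum_val q) + offset (fun c i => - phi (bs c, i)) (enum_val q)
  | inr (c, i) => phi (bs c, i)
  end.

Definition join_translation (z : (coords + K * 'I_n)%type -> R) (p : V * 'I_n) : R :=
  z (inl (enum_rank p)) + offset (fun c i => z (inr (c, i))) p.

Lemma offset_polyfun (I : finType) (y : (I -> R) -> K -> 'I_n -> R) p :
  (forall c i, polyfun (fun x => y x c i)) -> polyfun (fun x => offset (y x) p).
Proof.
by move=> h; rewrite /offset; case: (class_of p.1) => [c|]; [exact: h|exact: polyfun_const].
Qed.

(** The positions of the base vertices are the translation parameters. Which vertices move together
    is purely combinatorial, so the map and its inverse are polynomial. *)
Lemma config_isomorphism :
  isomorphism (config_space L) (prod_space n #|free_components| based_configurations)
    split_translation.
Proof.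
split.
  apply: polyfun_entire_rational => -[q|[c i]]; last exact: polyfun_coord.
  apply: polyfunD; first exact: polyfun_coord.
  apply: offset_polyfun => c i.
  apply: polyfun_eq (polyfunB (polyfun_const _ 0) (polyfun_coord _ (bs c, i))) => x.
  by rewrite sub0r.
exists join_translation; split.
- apply: polyfun_entire_rational => p; apply: polyfunD; first exact: polyfun_coord.
  by apply: offset_polyfun => c i; exact: polyfun_coord.
- move=> phi hphi; rewrite /prod_space /= /based_configurations /=.
  have -> : unflatten (fun q => split_translation phi (inl q)) =
      fun p => phi p + offset (fun c i => - phi (bs c, i)) p.
    by apply/funext => p; rewrite /unflatten /= enum_rankK.
  split; first exact: config_translate.
  by move=> c i; rewrite /offset /= class_of_base subrr.
- move=> z [hz _].
  have -> : join_translation z = fun p => unflatten (fun q => z (inl q)) p +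
      offset (fun c i => z (inr (c, i))) p by [].
  exact: config_translate.
- move=> phi hphi; apply/funext => p; rewrite /join_translation /= enum_rankK -addrA.
  by rewrite /offset; case: (class_of p.1) => [c|]; rewrite ?addNr !addr0 -?surjective_pairing.
- move=> z [_ hz]; apply/funext => -[q|[c i]] /=.
    rewrite /join_translation enum_valK -addrA /offset; case: (class_of _) => [c|] /=.
      have := hz c (enum_val q).2; rewrite /unflatten => ->.
      by rewrite class_of_base add0r subrr addr0.
    by rewrite !addr0.
  have := hz c i; rewrite /unflatten /join_translation => ->.
  by rewrite /offset /= class_of_base add0r.
Qed.

End ConfigurationSpace.

Lemma config_space_isomorphism (R : realType) (n : nat) (V : finType)
    (L : cabled_linkage R n V) :
  exists (N : nat) (X : set ('I_N -> R)),
    [/\ compact_set X, quasialgebraic X &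
        exists f, isomorphism (config_space L) (prod_space n (n_free_components L) X) f].
Proof.
have [bs bsP] := exists_bases L.
exists #|{: V * 'I_n}|, (based_configurations bs).
have qX := based_quasialgebraic bs.
split=> //; last by exists (split_translation bs); exact: config_isomorphism.
by have [b hb] := based_bounded bsP; exact: qa_compact hb.
Qed.

Unset Implicit Arguments.

Theorem theorem1p2 (R : realType) (n : nat) (hn : (2 <= n)%N) :
  (forall (V : finType) (L : cabled_linkage R n V),
     exists (N : nat) (X : set ('I_N -> R)),
       [/\ compact_set X, quasialgebraic X &
           exists f, isomorphism (config_space L)
                       (prod_space n (n_free_components L) X) f])
  /\
  (forall (j k : nat) (X : set ('I_j * 'I_n -> R)),
     compact_set X -> quasialgebraic X ->
     exists (m : nat) (L : cabled_linkage R n ('I_j + 'I_m)%type)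
            (alpha : ((('I_j * 'I_n) + ('I_k * 'I_n))%type -> R) -> ('I_m * 'I_n -> R)),
       [/\ exists f, analytic_isomorphism (config_space L) (prod_space n k X) f,
           restr_analytic (prod_space n k X) alpha,
           config_space L = graph_map alpha @` prod_space n k X &
           analytic_isomorphism (prod_space n k X) (config_space L)
             (graph_map alpha)]).
Proof.
by split=> [V L|j k X]; [exact: config_space_isomorphism|exact: quasialgebraic_realization].
Qed.
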